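(* Let $\rho:\mathcal{H}\to{\rm Spin}(7)$ be the inclusion. The pair $(\rho,\varepsilon)$ is unacceptable of type IIIa with respect to $\alpha$. Conversely, let $\Gamma$ be a group, $\chi:\Gamma\to\{\pm1\}$ a nontrivial character, and let $r:\Gamma\to{\rm Spin}(7)$ and $\eta:\Gamma\to\{\pm1\}$ be morphisms such that $(r,\eta)$ is unacceptable of type IIIa with respect to $\chi$. Then, up to replacing $r$ with a ${\rm Spin}(7)$-conjugate, there is a group morphism $f:\Gamma\to\mathcal{H}$ with $\rho\circ f=r$, $\chi=\alpha\circ f$ and $\eta=\varepsilon\circ f$.
   Context: Let $\pi:{\rm Spin}(7)\to{\rm SO}(7)$ be the canonical double cover (compact groups), with kernel $\{\pm1\}$, and let $E=\mathbb{R}^7$ be the standard representation of ${\rm Spin}(7)$ via $\pi$. A morphism $r:\Gamma\to{\rm Spin}(7)$ makes $E$ an $\mathbb{R}[\Gamma]$-module. Unacceptable pairs. For morphisms $r:\Gamma\to{\rm Spin}(7)$ and $\eta:\Gamma\to\{\pm1\}$, the pair $(r,\eta)$ is called unacceptable if $r(\gamma)$ and $\eta(\gamma)r(\gamma)$ are conjugate in ${\rm Spin}(7)$ for every $\gamma\in\Gamma$, but $r$ and $\eta r$ are not ${\rm Spin}(7)$-conjugate; otherwise it is called acceptable. ${\rm X}(r)$ denotes the group of characters $\psi:\Gamma\to\{\pm1\}$ for which there is $g\in{\rm Spin}(7)$ with $g\,r(\gamma)\,g^{-1}=\psi(\gamma)r(\gamma)$ for all $\gamma\in\Gamma$. Type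 III. Let $\chi:\Gamma\to\{\pm1\}$ be a nontrivial character with kernel $\Gamma_0$. A morphism $r:\Gamma\to{\rm Spin}(7)$ such that the $\mathbb{R}[\Gamma]$-module $E$ contains $\chi$ is called unacceptable of type III with respect to $\chi$ if $E$ does not contain the trivial representation of $\Gamma$ and there is an order $2$ character $\eta'$ of $\Gamma$ such that $(r,\eta')$ is unacceptable and $(r_{|\Gamma_0},\eta'_{|\Gamma_0})$ is acceptable. Type IIIa. Let $r$ be unacceptable of type III with respect to $\chi$, and write $E\simeq U\oplus\chi$ as an $\mathbb{R}[\Gamma]$-module. For an order $2$ character $\eta$ of $\Gamma$, the pair $(r,\eta)$ is called unacceptable of type IIIa with respect to $\chi$ if $\eta\notin{\rm X}(r)$ and there are an $\mathbb{R}[\Gamma_0]$-submodule $V_0\subset U$ with $\dim V_0=2$ and determinant $\eta_{|\Gamma_0}$, and an $\mathbb{R}[\Gamma]$-module $Q'$ with $\dim Q'=2$ and $\det Q'=\chi$, such that $U\simeq Q'\oplus{\rm Ind}_{\Gamma_0}^{\Gamma}V_0$. The group $\mathcal{H}$. Fix an orthogonal decomposition $\mathbb{R}^7=L\perp F$ with $L$ a line, and let $N\subset{\rm Spin}(7)$ be the inverse image under $\pi$ of the stabilizer of $L$; restriction to $F$ gives a surjection $N\to{\rm O}(F)$ with kernel $\{\pm1\}$. Fix an orthogonal decomposition $F=P\perp P'\perp Q$ into planes. Let $\underline{\mathcal{H}}\subset{\rm O}(F)$ be the subgroup of isometries that preserve the pair $\{P,P'\}$ and $Q$, have determinant $1$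 on $P\oplus P'$, and whose signature as a permutation of $\{P,P'\}$ coincides with their determinant on $Q$. Let $\alpha:\underline{\mathcal{H}}\to\{\pm1\}$ be the determinant on $Q$, and $\underline{\mathcal{H}}_0=\ker\alpha$. Let $\varepsilon:\underline{\mathcal{H}}\to\{\pm1\}$ be any of the two characters of $\underline{\mathcal{H}}$ which coincide with $\det P=\det P'$ on $\underline{\mathcal{H}}_0$ (the other one is $\alpha\varepsilon$). Then $\mathcal{H}\subset N\subset{\rm Spin}(7)$ is the inverse image of $\underline{\mathcal{H}}$ under $N\to{\rm O}(F)$, and $\alpha$, $\varepsilon$ are viewed as characters of $\mathcal{H}$ by inflation. *)

(* Defs.v *)
From HB Require Import structures.
From mathcomp Require Import all_boot all_order all_algebra.
From mathcomp Require Import boolp reals.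
From mathcomp Require Import ring.

Set Implicit Arguments.
Unset Strict Implicit.
Unset Printing Implicit Defensive.

Import Order.TTheory GRing.Theory Num.Theory.
Local Open Scope ring_scope.

Section SymmetricDifference.
Variable T : finType.
Implicit Types A B C : {set T}.

Definition symd A B : {set T} := (A :\: B) :|: (B :\: A).

Lemma in_symd A B i : (i \in symd A B) = (i \in A) (+) (i \in B).
Proof. by rewrite !inE; do 2!case: (_ \in _). Qed.

Lemma symdC A B : symd A B = symd B A.
Proof. by apply/setP => i; rewrite !in_symd addbC. Qed.

Lemma symdA A B C : symd A (symd B C) = symd (symd A B) C.
Proof. by apply/setP => i; rewrite !in_symd addbA. Qed.

Lemma symd0 A : symd A set0 = A.
Proof. by apply/setP => i; rewrite !in_symd inE addbF. Qed.

Lemma sym0d A : symd set0 A = A.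
Proof. by rewrite symdC symd0. Qed.

Lemma symdd A : symd A A = set0.
Proof. by apply/setP => i; rewrite !in_symd inE addbb. Qed.

Lemma symdK A B : symd A (symd A B) = B.
Proof. by rewrite symdA symdd sym0d. Qed.

Lemma prod_symd (K : comNzRingType) (f : T -> K) A B :
  (forall i, f i * f i = 1) ->
  \prod_(i in symd A B) f i = \prod_(i in A) f i * \prod_(i in B) f i.
Proof.
move=> ff; rewrite (big_mkcond (mem (symd A B))) (big_mkcond (mem A)).
rewrite (big_mkcond (mem B)) -big_split; apply: eq_bigr => i _ /=.
by rewrite in_symd; do 2!case: (_ \in _); rewrite ?ff ?mulr1 ?mul1r.
Qed.

End SymmetricDifference.

(* The basis is [e_A = e_{i_1} ... e_{i_k}] for [A = {i_1 < ... < i_k}], with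
   [e_i ^ 2 = 1] and [e_i e_j = - e_j e_i] for [i != j]; hence
   [e_A e_B = cliff_sign A B *: e_(symd A B)], the sign counting the pairs
   [(i, j)] of [A * B] with [j < i]; in [cliff_mul], the terms contributing to
   [e_C] are those with [symd A B = C], i.e. [B = symd A C]. *)
Definition clifford (R : realType) (n : nat) : Type := {ffun {set 'I_n} -> R}.

Section Clifford.
Variables (R : realType) (n : nat).
Implicit Types (A B C : {set 'I_n}) (x y z : clifford R n).

HB.instance Definition _ := Choice.copy (clifford R n) {ffun {set 'I_n} -> R}.
HB.instance Definition _ :=
  GRing.Lmodule.copy (clifford R n) {ffun {set 'I_n} -> R^o}.

Definition cliff_sign A B : R :=
  \prod_(i in A) \prod_(j in B) (if (j < i)%N then -1 else 1).

Definition cliff_one : clifford R n := [ffun C => (C == set0)%:R].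

Definition cliff_mul x y : clifford R n :=
  [ffun C => \sum_A cliff_sign A (symd A C) * (x A * y (symd A C))].

Let c (i j : 'I_n) : R := if (j < i)%N then -1 else 1.
Let cc i j : c i j * c i j = 1.
Proof. by rewrite /c; case: ifP; rewrite ?mulrNN mulr1. Qed.

Lemma cliff_signDr A B C :
  cliff_sign A (symd B C) = cliff_sign A B * cliff_sign A C.
Proof.
rewrite /cliff_sign -big_split; apply: eq_bigr => i _.
by apply: prod_symd => j; exact: cc.
Qed.

Lemma cliff_signDl A B C :
  cliff_sign (symd A B) C = cliff_sign A C * cliff_sign B C.
Proof.
rewrite /cliff_sign prod_symd // => i; rewrite -big_split.
by rewrite big1 // => j _; rewrite [LHS]cc.
Qed.

Lemma cliff_sign0l B : cliff_sign set0 B = 1.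
Proof. by rewrite /cliff_sign big_set0. Qed.

Lemma cliff_sign0r A : cliff_sign A set0 = 1.
Proof. by rewrite /cliff_sign big1 // => i _; rewrite big_set0. Qed.

Lemma cliff_sign_sqr A B : cliff_sign A B * cliff_sign A B = 1.
Proof. by rewrite -cliff_signDr symdd cliff_sign0r. Qed.

Fact cliff_mulA : associative cliff_mul.
Proof.
move=> x y z; apply/ffunP => D; rewrite !ffunE.
under eq_bigr => A _ do rewrite ffunE !mulr_sumr.
under [RHS]eq_bigr => C _ do rewrite ffunE mulr_suml mulr_sumr.
rewrite [RHS]exchange_big; apply: eq_bigr => A _ /=.
rewrite [RHS](reindex_inj (can_inj (symdK A))); apply: eq_bigr => B _ /=.
rewrite symdK -[symd (symd A B) D]symdA.
have -> : symd B (symd A D) = symd A (symd B D) by rewrite !symdA (symdC B).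
rewrite !(cliff_signDr, cliff_signDl) (symdC A (symd B D)) -symdA (symdC D).
have bb : cliff_sign A B * cliff_sign A B = 1 by exact: cliff_sign_sqr.
set b := cliff_sign A B in bb *.
by rewrite -[LHS]mul1r -bb; ring.
Qed.

Fact cliff_mul1x : left_id cliff_one cliff_mul.
Proof.
move=> x; apply/ffunP => C; rewrite ffunE (bigD1 set0) //= big1 ?addr0.
  by rewrite ffunE eqxx sym0d cliff_sign0l !mul1r.
by move=> A /negbTE A0; rewrite ffunE A0 mul0r mulr0.
Qed.

Fact cliff_mulx1 : right_id cliff_one cliff_mul.
Proof.
move=> x; apply/ffunP => C; rewrite ffunE (bigD1 C) //= big1 ?addr0.
  by rewrite ffunE symdd eqxx cliff_sign0r mul1r mulr1.
move=> A AC; rewrite ffunE; case: eqP => [AC0|]; last by rewrite !mulr0.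
by case/eqP: AC; rewrite -[A]symd0 -AC0 symdK.
Qed.

Fact cliff_mulDl : left_distributive cliff_mul +%R.
Proof.
move=> x y z; apply/ffunP => C; rewrite !ffunE -big_split.
by apply: eq_bigr => A _; rewrite !ffunE /= mulrDl mulrDr.
Qed.

Fact cliff_mulDr : right_distributive cliff_mul +%R.
Proof.
move=> x y z; apply/ffunP => C; rewrite !ffunE -big_split.
by apply: eq_bigr => A _; rewrite !ffunE /= !mulrDr.
Qed.

Fact cliff_one_neq0 : cliff_one != 0.
Proof. by apply/eqP => /ffunP/(_ set0)/eqP; rewrite !ffunE eqxx oner_eq0. Qed.

HB.instance Definition _ := GRing.Zmodule_isNzRing.Build (clifford R n)
  cliff_mulA cliff_mul1x cliff_mulx1 cliff_mulDl cliff_mulDr cliff_one_neq0.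

Lemma cliffZE (a : R) x A : (a *: x) A = a * x A.
Proof. by rewrite ffunE. Qed.

Fact cliff_scaleAl (a : R) x y : a *: (x * y) = (a *: x) * y.
Proof.
apply/ffunP => C; rewrite cliffZE !ffunE mulr_sumr.
by apply: eq_bigr => A _; rewrite cliffZE; ring.
Qed.

HB.instance Definition _ :=
  GRing.Lmodule_isLalgebra.Build R (clifford R n) cliff_scaleAl.

Fact cliff_scaleAr (a : R) x y : a *: (x * y) = x * (a *: y).
Proof.
apply/ffunP => C; rewrite cliffZE !ffunE mulr_sumr.
by apply: eq_bigr => A _; rewrite cliffZE; ring.
Qed.

HB.instance Definition _ :=
  GRing.Lalgebra_isAlgebra.Build R (clifford R n) cliff_scaleAr.

End Clifford.

Definition dotv (R : realType) (n : nat) (u v : 'cV[R]_n) : R := (u^T *m v) 0 0.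

Section Dot.
Variables (R : realType) (n : nat).
Implicit Types u v w : 'cV[R]_n.

Lemma dotvE u v : dotv u v = \sum_i u i 0 * v i 0.
Proof. by rewrite /dotv mxE; apply: eq_bigr => i _; rewrite mxE. Qed.

Lemma dotvC u v : dotv u v = dotv v u.
Proof. by rewrite !dotvE; apply: eq_bigr => i _; rewrite mulrC. Qed.

Lemma dotvDl u v w : dotv (u + v) w = dotv u w + dotv v w.
Proof. by rewrite /dotv linearD mulmxDl mxE. Qed.

Lemma dotvDr u v w : dotv w (u + v) = dotv w u + dotv w v.
Proof. by rewrite /dotv mulmxDr mxE. Qed.

Lemma dotvBl u v w : dotv (u - v) w = dotv u w - dotv v w.
Proof. by rewrite /dotv linearB mulmxBl mxE [X in _ + X]mxE. Qed.

Lemma dotvv_eq0 u : dotv u u = 0 -> u = 0.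
Proof.
move=> /eqP; rewrite dotvE psumr_eq0 => [/allP uu|i _]; last exact: sqr_ge0.
apply/colP => i; apply/eqP; have /(_ i) := uu; rewrite mem_index_enum.
by move=> /(_ isT); rewrite /= mulf_eq0 orbb mxE.
Qed.

End Dot.

Definition clv (R : realType) (n : nat) (v : 'cV[R]_n) : clifford R n :=
  [ffun C => \sum_i v i 0 * (C == [set i])%:R].

Section CliffordVectors.
Variables (R : realType) (n : nat).
Implicit Types (u v w : 'cV[R]_n).

Lemma clvi v i : clv v [set i] = v i 0.
Proof.
rewrite ffunE (bigD1 i) //= eqxx mulr1 big1 ?addr0 // => j ji.
by rewrite (inj_eq set1_inj) eq_sym (negbTE ji) mulr0.
Qed.

Lemma clv_inj : injective (@clv R n).
Proof. by move=> u v uv; apply/colP => i; rewrite -!clvi uv. Qed.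

Fact clv_is_linear : linear (@clv R n).
Proof.
move=> a u v; apply/ffunP => C; rewrite [RHS]ffunE cliffZE !ffunE mulr_sumr.
by rewrite -big_split; apply: eq_bigr => i _; rewrite !mxE /=; ring.
Qed.

HB.instance Definition _ :=
  GRing.isLinear.Build R 'cV[R]_n (clifford R n) _ (@clv R n) clv_is_linear.

Let e (i : 'I_n) : clifford R n := clv (delta_mx i 0).

Let eE i C : e i C = (C == [set i])%:R.
Proof.
rewrite ffunE (bigD1 i) //= mxE !eqxx mul1r big1 ?addr0 // => j ji.
by rewrite mxE (negbTE ji) mul0r.
Qed.

Let clv_sum v : clv v = \sum_i v i 0 *: e i.
Proof.
apply/ffunP => C; rewrite sum_ffunE ffunE; apply: eq_bigr => i _.
by rewrite cliffZE eE.
Qed.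

Let eM i j C :
  (e i * e j) C = cliff_sign R [set i] [set j] * (symd [set i] C == [set j])%:R.
Proof.
rewrite ffunE (bigD1 [set i]) //= big1 ?addr0; last first.
  by move=> A /negbTE Ai; rewrite eE Ai mul0r mulr0.
rewrite !eE eqxx mul1r; case: eqP => [->|]; last by rewrite !mulr0.
by [].
Qed.

Let eD i j : e i * e j + e j * e i = (2 * (i == j)%:R)%:A.
Proof.
apply/ffunP => C; rewrite [LHS]ffunE cliffZE !eM ffunE /cliff_sign !big_set1.
have symE (k l : 'I_n) :
    (symd [set k] C == [set l]) = (C == symd [set k] [set l]).
  by apply/eqP/eqP => [<-|->]; rewrite symdK.
rewrite !symE (symdC [set j]); have [<-|ij] := eqVneq i j.
  by rewrite ltnn symdd !mul1r mulr1; ring.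
rewrite mulr0 mul0r.
by case: ltngtP ij => [_ _|_ _|/val_inj-> /eqP//]; rewrite mulN1r mul1r
  ?subrr ?addNr.
Qed.

Lemma clvM u v : clv u * clv v + clv v * clv u = (2 * dotv u v)%:A.
Proof.
rewrite !clv_sum dotvE !mulr_suml.
under eq_bigr => i _ do rewrite mulr_sumr.
under [X in _ + X]eq_bigr => i _ do rewrite mulr_sumr.
rewrite [X in _ + X]exchange_big -big_split /= mulr_sumr scaler_suml.
apply: eq_bigr => i _; rewrite -big_split (bigD1 i) //= big1 ?addr0.
  rewrite -!scalerAl -!scalerAr (scalerA (v i 0)) (scalerA (u i 0)).
  rewrite (mulrC (v i 0)) -scalerDr eD eqxx scalerA.
  by congr (_ *: _); rewrite mulr1 mulrC.
move=> j /negbTE ji; rewrite -!scalerAl -!scalerAr !scalerA.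
by rewrite (mulrC (v j 0)) -scalerDr eD eq_sym ji mulr0 scale0r scaler0.
Qed.

Lemma clv_sqr v : clv v * clv v = (dotv v v)%:A.
Proof.
have two : (2 : R) != 0 by rewrite pnatr_eq0.
apply: (scalerI two); rewrite scalerA -clvM.
by rewrite -[2]/(1 + 1) scalerDl !scale1r.
Qed.

End CliffordVectors.

Definition is_spin (R : realType) (n : nat) (x : clifford R n) : Prop :=
  exists s : seq 'cV[R]_n,
    [/\ ~~ odd (size s), {in s, forall v, dotv v v = 1}
      & x = \prod_(v <- s) clv v].

Record spin (R : realType) (n : nat) := Spin {
  spin_val :> clifford R n;
  _ : `[< is_spin spin_val >]
}.

Section SpinGroup.
Variables (R : realType) (n : nat).

HB.instance Definition _ := [isSub for @spin_val R n].
HB.instance Definition _ := [Choice of spin R n by <:].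

Implicit Types x y : spin R n.

Fact spin1_subproof : `[< is_spin (1 : clifford R n) >].
Proof. by apply/asboolP; exists [::]; rewrite big_nil. Qed.

Fact spinM_subproof x y : `[< is_spin (val x * val y) >].
Proof.
case: x y => [x /= /asboolP[s [so su ->]]] [y /= /asboolP[t [to tu ->]]].
apply/asboolP; exists (s ++ t); split; last by rewrite big_cat.
  by rewrite size_cat oddD (negbTE so).
by move=> v; rewrite mem_cat => /orP[/su|/tu].
Qed.

Lemma prod_clv_rev (s : seq 'cV[R]_n) : {in s, forall v, dotv v v = 1} ->
  (\prod_(v <- rev s) clv v) * (\prod_(v <- s) clv v) = 1.
Proof.
elim: s => [|v s IHs] su; first by rewrite !big_nil mulr1.
rewrite rev_cons -cats1 big_cat big_seq1 big_cons /= mulrA -(mulrA _ _ (clv v)).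
rewrite clv_sqr su ?mem_head // scale1r mulr1 IHs // => w ws.
by rewrite su // in_cons ws orbT.
Qed.

Fact spinV_subproof x : exists y, val y * val x = 1 /\ val x * val y = 1.
Proof.
case: x => [x /= /asboolP[s [so su ->]]].
have ru : {in rev s, forall v, dotv v v = 1} by move=> v; rewrite mem_rev => /su.
have ys : `[< is_spin (\prod_(v <- rev s) clv v) >].
  by apply/asboolP; exists (rev s); rewrite size_rev.
exists (Spin ys); split; first exact: prod_clv_rev.
by have /= := prod_clv_rev ru; rewrite revK.
Qed.

Definition spin_one : spin R n := Spin spin1_subproof.
Definition spin_mul x y : spin R n := Spin (spinM_subproof x y).
Definition spin_inv x : spin R n := sval (cid (spinV_subproof x)).

Fact spin_mulA : associative spin_mul.
Proof. by move=> x y z; apply/val_inj/mulrA. Qed.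
Fact spin_mul1g : left_id spin_one spin_mul.
Proof. by move=> x; apply/val_inj/mul1r. Qed.
Fact spin_mulg1 : right_id spin_one spin_mul.
Proof. by move=> x; apply/val_inj/mulr1. Qed.
Fact spin_mulVg : left_inverse spin_one spin_inv spin_mul.
Proof. by move=> x; apply/val_inj; case: (svalP (cid (spinV_subproof x))). Qed.
Fact spin_mulgV : right_inverse spin_one spin_inv spin_mul.
Proof. by move=> x; apply/val_inj; case: (svalP (cid (spinV_subproof x))). Qed.

HB.instance Definition _ := isGroup.Build (spin R n)
  spin_mulA spin_mul1g spin_mulg1 spin_mulVg spin_mulgV.

Lemma spin_valM x y : val (x * y)%g = val x * val y. Proof. by []. Qed.
Lemma spin_val1 : val (1%g : spin R n) = 1. Proof. by []. Qed.
Lemma spin_valK x : val x * val x^-1%g = 1.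
Proof. by rewrite -spin_valM mulgV. Qed.
Lemma spin_valVK x : val x^-1%g * val x = 1.
Proof. by rewrite -spin_valM mulVg. Qed.

(* [spin_pi x] is the matrix of the endomorphism [v |-> x v x^-1] of [R^n];
   see [spin_piP]. *)
Definition spin_pi x : 'M[R]_n :=
  \matrix_(i, j) (val x * clv (delta_mx j 0) * val x^-1%g : clifford R n) [set i].

Lemma spin_conj_clv x v : exists w, val x * clv v * val x^-1%g = clv w.
Proof.
have : exists s : seq 'cV[R]_n, {in s, forall v, dotv v v = 1} /\
    val x = \prod_(v <- s) clv v.
  by case: x => [x /= /asboolP[s [_ su ->]]]; exists s.
case=> s [su xs].
have -> : val x^-1%g = \prod_(v <- rev s) clv v.
  by rewrite -[LHS]mul1r -[X in X * _](prod_clv_rev su) -xs -mulrA spin_valK mulr1.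
rewrite {}xs; elim: s su => [|u s IHs] su.
  by exists v; rewrite !big_nil mulr1 mul1r.
have [|w sw] := IHs; first by move=> z zs; rewrite su // in_cons zs orbT.
rewrite rev_cons -cats1 big_cat big_seq1 big_cons /=.
exists ((2 * dotv u w) *: u - w); rewrite !mulrA -(mulrA (clv u)).
rewrite -(mulrA (clv u)) sw linearB linearZ /=.
have -> : clv u * clv w = (2 * dotv u w)%:A - clv w * clv u.
  by rewrite -clvM addrK.
by rewrite mulrBl -scalerAl mul1r -mulrA clv_sqr su ?mem_head // scale1r mulr1.
Qed.

Lemma spin_piP x v : clv (spin_pi x *m v) = val x * clv v * val x^-1%g.
Proof.
have colE j : clv (col j (spin_pi x)) =
    val x * clv (delta_mx j 0) * val x^-1%g.
  have [w xw] := spin_conj_clv x (delta_mx j 0); rewrite xw; congr clv.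
  by apply/colP => i; rewrite !mxE xw clvi.
have -> : spin_pi x *m v = \sum_j v j 0 *: col j (spin_pi x).
  apply/colP => i; rewrite summxE mxE; apply: eq_bigr => j _.
  by rewrite !mxE mulrC.
rewrite linear_sum /= [v in RHS]matrix_sum_delta exchange_big big_ord1.
rewrite linear_sum mulr_sumr mulr_suml; apply: eq_bigr => j _.
by rewrite !linearZ /= colE -scalerAr -scalerAl.
Qed.

Lemma spin_piM x y : spin_pi (x * y)%g = spin_pi x *m spin_pi y.
Proof.
apply/matrixP => i j; have /colP/(_ i) : spin_pi (x * y)%g *m delta_mx j 0 =
    (spin_pi x *m spin_pi y) *m (delta_mx j 0 : 'cV_n).
  apply: clv_inj; rewrite -mulmxA !spin_piP.
  have -> : ((x * y)^-1 = y^-1 * x^-1)%g by rewrite invgM.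
  by rewrite !spin_valM !mulrA.
by rewrite -!colE !mxE.
Qed.

Lemma spin_pi1 : spin_pi 1%g = 1%:M.
Proof.
apply/matrixP => i j; rewrite mxE invg1 spin_val1 mulr1 mul1r clvi !mxE.
by rewrite eqxx andbT eq_sym.
Qed.

Lemma spin_pi_dot x u v : dotv (spin_pi x *m u) (spin_pi x *m v) = dotv u v.
Proof.
have := clvM (spin_pi x *m u) (spin_pi x *m v); rewrite !spin_piP !mulrA.
rewrite -(mulrA (val x * clv u)) -(mulrA (val x * clv v)) spin_valVK !mulr1.
rewrite -(mulrA (val x)) -(mulrA (val x) (clv v)) -mulrDl -mulrDr clvM.
rewrite -scalerAr mulr1 -scalerAl spin_valK.
move=> /ffunP/(_ set0); rewrite !cliffZE ffunE eqxx !mulr1.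
by move/(mulfI _)->; rewrite // pnatr_eq0.
Qed.

Definition spin_lfun x : 'End('cV[R]_n) := linfun (mulmx (spin_pi x)).

Lemma spin_lfunM x y : spin_lfun (x * y)%g = (spin_lfun x \o spin_lfun y)%VF.
Proof. by apply/lfunP => v; rewrite comp_lfunE !lfunE /= spin_piM mulmxA. Qed.

Lemma spin_lfun1 : spin_lfun 1%g = \1%VF.
Proof. by apply/lfunP => v; rewrite !lfunE /= spin_pi1 mul1mx. Qed.

End SpinGroup.

Record isom (R : realType) (n : nat) (F : {vspace 'cV[R]_n}) := Isom {
  isom_val :> 'End(subvs_of F);
  _ : `[< forall u v : subvs_of F,
            dotv (vsval (isom_val u)) (vsval (isom_val v))
            = dotv (vsval u) (vsval v) >]
}.

Section IsomGroup.
Variables (R : realType) (n : nat) (F : {vspace 'cV[R]_n}).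

HB.instance Definition _ := [isSub for @isom_val R n F].
HB.instance Definition _ := [Choice of isom F by <:].

Implicit Types f g h : isom F.

Lemma isom_dot f u v :
  dotv (vsval (f u)) (vsval (f v)) = dotv (vsval u) (vsval v).
Proof. by case: f => f /= /asboolP; apply. Qed.

Lemma isom_lker0 f : lker f == 0%VS.
Proof.
apply/lker0P => u v fuv; apply/eqP; rewrite -subr_eq0; apply/eqP/val_inj.
by apply: dotvv_eq0; rewrite -(isom_dot f) linearB /= fuv subrr /dotv mulmx0 mxE.
Qed.

Fact isom1_subproof : `[< forall u v : subvs_of F,
  dotv (vsval (\1%VF u)) (vsval (\1%VF v)) = dotv (vsval u) (vsval v) >].
Proof. by apply/asboolP => u v; rewrite !lfunE. Qed.

Fact isomM_subproof f g : `[< forall u v : subvs_of F,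
  dotv (vsval ((val f \o val g)%VF u)) (vsval ((val f \o val g)%VF v))
  = dotv (vsval u) (vsval v) >].
Proof. by apply/asboolP => u v; rewrite !comp_lfunE !isom_dot. Qed.

Fact isomV_subproof f : `[< forall u v : subvs_of F,
  dotv (vsval ((val f)^-1%VF u)) (vsval ((val f)^-1%VF v))
  = dotv (vsval u) (vsval v) >].
Proof.
apply/asboolP => u v; rewrite -(isom_dot f) -!(comp_lfunE f).
by rewrite lker0_compfV ?isom_lker0 // !lfunE.
Qed.

Definition isom_one : isom F := Isom isom1_subproof.
Definition isom_mul f g : isom F := Isom (isomM_subproof f g).
Definition isom_inv f : isom F := Isom (isomV_subproof f).

Fact isom_mulA : associative isom_mul.
Proof. by move=> f g h; apply/val_inj/comp_lfunA. Qed.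
Fact isom_mul1g : left_id isom_one isom_mul.
Proof. by move=> f; apply/val_inj/comp_lfun1l. Qed.
Fact isom_mulg1 : right_id isom_one isom_mul.
Proof. by move=> f; apply/val_inj/comp_lfun1r. Qed.
Fact isom_mulVg : left_inverse isom_one isom_inv isom_mul.
Proof. by move=> f; apply/val_inj/lker0_compVf/isom_lker0. Qed.
Fact isom_mulgV : right_inverse isom_one isom_inv isom_mul.
Proof. by move=> f; apply/val_inj/lker0_compfV/isom_lker0. Qed.

HB.instance Definition _ := isGroup.Build (isom F)
  isom_mulA isom_mul1g isom_mulg1 isom_mulVg isom_mulgV.

Lemma isom_valM f g : val (f * g)%g = (val f \o val g)%VF. Proof. by []. Qed.
Lemma isom_val1 : val (1%g : isom F) = \1%VF. Proof. by []. Qed.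

End IsomGroup.

(* The determinant of the endomorphism of [U] induced by [f], when [f] maps [U]
   to itself: [\det] of its matrix in a basis of [U]. *)
Definition det_on (K : fieldType) (vT : vectType K) (U : {vspace vT})
    (f : 'End(vT)) : K :=
  \det (\matrix_(i, j) coord (vbasis U) i (f (vbasis U)`_j)).

Section DetOn.
Variables (K : fieldType) (vT : vectType K) (U : {vspace vT}).
Implicit Types f g : 'End(vT).

Lemma det_on1 : det_on U \1%VF = 1.
Proof.
rewrite -(det1 K (\dim U)); congr (\det _); apply/matrixP => i j.
by rewrite !mxE lfunE /= (coord_free _ _ (basis_free (vbasisP U))) eq_sym.
Qed.

Lemma det_onM f g :
  (g @: U <= U)%VS -> det_on U (f \o g)%VF = det_on U f * det_on U g.
Proof.
move=> gU; rewrite -det_mulmx; congr (\det _); apply/matrixP => i j.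
rewrite !mxE comp_lfunE /=.
have /coord_vbasis{1}-> : g (vbasis U)`_j \in U.
  apply: (subvP gU); apply: memv_img; apply: vbasis_mem.
  by apply: mem_nth; rewrite size_tuple.
rewrite !linear_sum; apply: eq_bigr => k _.
by rewrite !linearZ /= !mxE mulrC.
Qed.

End DetOn.

Section StabL.
Variables (R : realType) (n : nat) (L : {vspace 'cV[R]_n}).

Record spin_stab := SpinStab {
  spin_stab_val :> spin R n;
  _ : (spin_lfun spin_stab_val @: L)%VS == L
}.

HB.instance Definition _ := [isSub for spin_stab_val].
HB.instance Definition _ := [Choice of spin_stab by <:].

Fact spin_stab_group : group_closed
  [pred x : spin R n | (spin_lfun x @: L)%VS == L].
Proof.
split=> [|x y]; rewrite !inE ?spin_lfun1 ?lim1g // => /eqP xL /eqP yL.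
have {1}<- := yL; rewrite -limg_comp -spin_lfunM -mulgA mulVg mulg1.
by rewrite xL.
Qed.

HB.instance Definition _ :=
  SubChoice_isSubGroup.Build (spin R n) _ spin_stab spin_stab_group.

End StabL.

Section Restriction.
Variables (R : realType) (n : nat) (L F : {vspace 'cV[R]_n}).
Implicit Types x y : spin_stab L.

Definition restr_lfun x : 'End(subvs_of F) :=
  linfun (vsproj F \o mulmx (spin_pi x) \o vsval).

Hypothesis orthLF : forall u v, u \in L -> v \in F -> dotv u v = 0.
Hypothesis fullLF : (L + F)%VS = fullv.

Lemma spin_stab_perp x u : u \in F -> spin_pi x *m u \in F.
Proof using orthLF fullLF.
move=> uF; have : spin_pi x *m u \in (L + F)%VS by rewrite fullLF memvf.
case/memv_addP => l lL [f fF xu]; suff -> : spin_pi x *m u = f by [].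
rewrite xu; suff -> : l = 0 by rewrite add0r.
apply: dotvv_eq0; have -> : dotv l l = dotv (spin_pi x *m u) l.
  by rewrite xu dotvDl (dotvC f) (orthLF lL fF) addr0.
have /eqP xL : (spin_lfun x @: L)%VS == L by case: (x).
have /memv_imgP[l' l'L ->] : l \in (spin_lfun x @: L)%VS by rewrite xL.
by rewrite lfunE /= spin_pi_dot dotvC orthLF.
Qed.

Lemma restr_lfunE x u : vsval (restr_lfun x u) = spin_pi x *m vsval u.
Proof using orthLF fullLF.
by rewrite lfunE /= vsprojK // spin_stab_perp // subvsP.
Qed.

Fact restr_subproof x : `[< forall u v : subvs_of F,
  dotv (vsval (restr_lfun x u)) (vsval (restr_lfun x v))
  = dotv (vsval u) (vsval v) >].
Proof using orthLF fullLF.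
by apply/asboolP => u v; rewrite !restr_lfunE spin_pi_dot.
Qed.

Definition restr x : isom F := Isom (restr_subproof x).

Fact restrM : {morph restr : x y / (x * y)%g}.
Proof.
move=> x y; apply/val_inj/lfunP => u; apply/val_inj.
by rewrite isom_valM comp_lfunE /= !restr_lfunE spin_piM mulmxA.
Qed.

End Restriction.

Record frame (R : realType) := Frame {
  frL : {vspace 'cV[R]_7};
  frF : {vspace 'cV[R]_7};
  frLF_orth : forall u v, u \in frL -> v \in frF -> dotv u v = 0;
  frLF_full : (frL + frF)%VS = fullv;
  frL_dim : \dim frL = 1%N;
  frP : {vspace subvs_of frF};
  frP' : {vspace subvs_of frF};
  frQ : {vspace subvs_of frF};
  frPP'_orth : forall u v, u \in frP -> v \in frP' -> dotv (vsval u) (vsval v) = 0;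
  frPQ_orth : forall u v, u \in frP -> v \in frQ -> dotv (vsval u) (vsval v) = 0;
  frP'Q_orth : forall u v, u \in frP' -> v \in frQ -> dotv (vsval u) (vsval v) = 0;
  frPP'Q_full : (frP + frP' + frQ)%VS = fullv;
  frP_dim : \dim frP = 2%N;
  frP'_dim : \dim frP' = 2%N;
  frQ_dim : \dim frQ = 2%N
}.

Section GroupH.
Variables (R : realType) (D : frame R).

Let F := frF D.
Let P := frP D.
Let P' := frP' D.
Let Q := frQ D.

(* The signature of the permutation of [{P, P'}] induced by [f], for an [f]
   preserving this pair. *)
Definition perm_sign (f : 'End(subvs_of F)) : R :=
  if (f @: P == P)%VS then 1 else -1.

Definition in_hbar (f : 'End(subvs_of F)) : Prop :=
  [/\ ((f @: P)%VS = P /\ (f @: P')%VS = P')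
      \/ ((f @: P)%VS = P' /\ (f @: P')%VS = P),
      (f @: Q)%VS = Q,
      det_on (P + P') f = 1
    & perm_sign f = det_on Q f].

Record hbar := HBar {
  hbar_val :> isom F;
  _ : `[< in_hbar hbar_val >]
}.

HB.instance Definition _ := [isSub for hbar_val].
HB.instance Definition _ := [Choice of hbar by <:].

Lemma frPP'_neq : P != P'.
Proof.
apply/eqP => PP'; have := frP_dim D; rewrite -/P.
suff -> : P = 0%VS by rewrite dimv0.
apply/eqP; rewrite -subv0; apply/subvP => u uP; rewrite memv0; apply/eqP.
by apply/val_inj/dotvv_eq0/(frPP'_orth uP); rewrite -/P' -PP'.
Qed.

Lemma in_hbar1 : in_hbar \1%VF.
Proof.
by split; rewrite ?lim1g ?det_on1 /perm_sign ?lim1g ?eqxx //; left.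
Qed.

Lemma perm_signM f g : in_hbar f -> in_hbar g ->
  perm_sign (f \o g)%VF = perm_sign f * perm_sign g.
Proof.
have P'P : (P' == P) = false by rewrite eq_sym; exact/negbTE/frPP'_neq.
case=> fP _ _ _ [gP _ _ _]; rewrite /perm_sign limg_comp.
by case: fP gP => [[fP fP']|[fP fP']] [[-> _]|[-> _]];
  rewrite ?fP ?fP' ?eqxx ?P'P ?mulr1 ?mul1r ?mulrNN ?mulr1.
Qed.

Lemma in_hbarM f g : in_hbar f -> in_hbar g -> in_hbar (f \o g)%VF.
Proof.
move=> Hf Hg; have sM := perm_signM Hf Hg.
case: Hf => fP fQ fd fs; case: Hg => gP gQ gd gs; split.
- rewrite !limg_comp.
  by case: fP gP => [[fP fP']|[fP fP']] [[-> ->]|[-> ->]]; rewrite ?fP ?fP';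
    by [left | right].
- by rewrite limg_comp gQ fQ.
- rewrite det_onM ?fd ?gd ?mulr1 // limgD.
  by case: gP => [[-> ->]|[-> ->]] //; rewrite addvC.
- by rewrite sM fs gs det_onM // gQ.
Qed.

Lemma in_hbarV (f : isom F) : in_hbar f -> in_hbar (f^-1)%g.
Proof.
move=> Hf; have ff : (val (f^-1)%g \o f)%VF = \1%VF.
  by rewrite -isom_valM mulVg.
have inv U V : (f @: U)%VS = V -> (val (f^-1)%g @: V)%VS = U.
  by move=> <-; rewrite -limg_comp ff lim1g.
case: Hf => fP fQ fd fs; split.
- by case: fP => [[/inv fP /inv fP']|[/inv fP /inv fP']]; [left|right].
- exact: inv.
- rewrite -[LHS]mulr1 -[X in _ * X]fd -det_onM ?ff ?det_on1 // limgD.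
  by case: fP => [[-> ->]|[-> ->]] //; rewrite addvC.
- have : det_on Q (val (f^-1)%g) * det_on Q f = 1.
    by rewrite -det_onM ?ff ?det_on1 // fQ.
  have -> : perm_sign (val (f^-1)%g) = perm_sign f.
    rewrite /perm_sign; congr (if _ then _ else _).
    apply/eqP/eqP => [/(congr1 (lfun_img f))|/inv //].
    by rewrite -limg_comp -isom_valM mulgV lim1g.
  rewrite -fs /perm_sign; case: ifP => _; first by rewrite mulr1.
  by rewrite mulrN1 => <-; rewrite opprK.
Qed.

Fact hbar_group : group_closed [pred f : isom F | `[< in_hbar f >]].
Proof.
split=> [|f g]; rewrite !inE; first by apply/asboolP; exact: in_hbar1.
by move=> /asboolP Hf /asboolP /in_hbarV Hg; apply/asboolP/in_hbarM.
Qed.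

HB.instance Definition _ :=
  SubChoice_isSubGroup.Build (isom F) _ hbar hbar_group.

Definition restrF : spin_stab (frL D) -> isom F :=
  restr (@frLF_orth R D) (frLF_full D).

Record hgrp := HGrp {
  hgrp_val :> spin_stab (frL D);
  _ : `[< in_hbar (restrF hgrp_val) >]
}.

HB.instance Definition _ := [isSub for hgrp_val].
HB.instance Definition _ := [Choice of hgrp by <:].

HB.instance Definition _ := isMultiplicative.Build _ _ restrF
  (restrM (@frLF_orth R D) (frLF_full D)).

Fact hgrp_group :
  group_closed [pred x : spin_stab (frL D) | `[< in_hbar (restrF x) >]].
Proof.
have r1 : restrF 1%g = 1%g.
  by apply: (mulgI (restrF 1%g)); rewrite -gmulfM !mulg1.
have rV x : restrF (x^-1)%g = (restrF x)^-1%g.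
  by apply: (mulgI (restrF x)); rewrite mulgV -gmulfM mulgV.
split=> [|x y]; rewrite !inE.
  by apply/asboolP; rewrite r1; exact: in_hbar1.
move=> /asboolP Hx /asboolP /in_hbarV Hy; apply/asboolP.
have -> : restrF (x / y)%g = (restrF x / restrF y)%g by rewrite -rV -gmulfM.
exact: in_hbarM.
Qed.

HB.instance Definition _ :=
  SubChoice_isSubGroup.Build (spin_stab (frL D)) _ hgrp hgrp_group.

Fact hgrp_hbar_subproof (x : hgrp) : `[< in_hbar (restrF x) >].
Proof. by case: x. Qed.

Definition hgrp_hbar (x : hgrp) : hbar := HBar (hgrp_hbar_subproof x).

Fact hgrp_hbarM : {morph hgrp_hbar : x y / (x * y)%g}.
Proof. by move=> x y; apply/val_inj; rewrite /= gmulfM. Qed.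

HB.instance Definition _ := isMultiplicative.Build hgrp hbar hgrp_hbar hgrp_hbarM.

Definition hgrp_incl (x : hgrp) : spin R 7 := x.

Fact hgrp_inclM : {morph hgrp_incl : x y / (x * y)%g}.
Proof. by []. Qed.

HB.instance Definition _ :=
  isMultiplicative.Build hgrp (spin R 7) hgrp_incl hgrp_inclM.

End GroupH.

Record sgnchar (R : realType) (G : groupType) := SgnChar {
  sgn_val :> G -> R;
  sgnM : forall x y, sgn_val (x * y)%g = sgn_val x * sgn_val y;
  sgn_pm1 : forall x, sgn_val x = 1 \/ sgn_val x = -1
}.

Section SgnChar.
Variables (R : realType) (G : groupType).
Implicit Types chi : sgnchar R G.

Lemma sgn1 chi : chi 1%g = 1.
Proof.
have : chi 1%g * chi 1%g = chi 1%g by rewrite -sgnM mulg1.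
by case: (sgn_pm1 chi 1%g) => ->; rewrite ?mulr1 // mulrNN mulr1.
Qed.

Lemma sgnV chi x : chi (x^-1)%g = chi x.
Proof.
have : chi x * chi (x^-1)%g = 1 by rewrite -sgnM mulgV sgn1.
by case: (sgn_pm1 chi x) => ->; rewrite ?mul1r // mulN1r => <-; rewrite opprK.
Qed.

(* A character [G -> {1, -1}] is trivial or of order 2. *)
Definition sgn_nontrivial chi : Prop := exists x, chi x <> 1.

Record sgnker chi := SgnKer { sgnker_val :> G; _ : chi sgnker_val == 1 }.

HB.instance Definition _ chi := [isSub for @sgnker_val chi].
HB.instance Definition _ chi := [Choice of sgnker chi by <:].

Fact sgnker_group chi : group_closed [pred x | chi x == 1].
Proof.
split=> [|x y]; rewrite !inE ?sgn1 // => /eqP x1 /eqP y1.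
by rewrite sgnM sgnV x1 y1 mulr1.
Qed.

HB.instance Definition _ chi :=
  SubChoice_isSubGroup.Build G _ (sgnker chi) (sgnker_group chi).

Definition ker_incl chi (x : sgnker chi) : G := x.

HB.instance Definition _ chi := isMultiplicative.Build (sgnker chi) G
  (@ker_incl chi) (fun x y => erefl).

Definition sgn_triv : sgnchar R G :=
  SgnChar (fun _ _ => esym (mulr1 1)) (fun _ => or_introl erefl).

End SgnChar.

Section SgnPullback.
Variables (R : realType) (G H : groupType).
Variables (f : {multiplicative G -> H}) (chi : sgnchar R H).

Fact sgn_pullM x y : chi (f (x * y)%g) = chi (f x) * chi (f y).
Proof. by rewrite gmulfM sgnM. Qed.

Definition sgn_pull : sgnchar R G :=
  SgnChar sgn_pullM (fun x => sgn_pm1 chi (f x)).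

End SgnPullback.

(* [G] acts on column vectors, on the left. *)
Record rep (R : realType) (G : groupType) (n : nat) := Rep {
  rep_val :> G -> 'M[R]_n;
  rep1 : rep_val 1%g = 1%:M;
  repM : forall x y, rep_val (x * y)%g = rep_val x *m rep_val y
}.

Section Rep.
Variables (R : realType) (G : groupType).

Definition rep_iso n m (V : rep R G n) (W : rep R G m) : Prop :=
  exists (A : 'M[R]_(m, n)) (B : 'M[R]_(n, m)),
    [/\ A *m B = 1%:M, B *m A = 1%:M & forall x, A *m V x = W x *m A].

(* [V] has a submodule isomorphic to [W]. *)
Definition rep_contains n m (V : rep R G n) (W : rep R G m) : Prop :=
  exists A : 'M[R]_(n, m), \rank A = m /\ forall x, V x *m A = A *m W x.

Section Sum.
Variables (n m : nat) (V : rep R G n) (W : rep R G m).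

Fact rep_sum1 : block_mx (V 1%g) 0 0 (W 1%g) = 1%:M.
Proof. by rewrite !rep1 -scalar_mx_block. Qed.

Fact rep_sumM x y : block_mx (V (x * y)%g) 0 0 (W (x * y)%g) =
  block_mx (V x) 0 0 (W x) *m block_mx (V y) 0 0 (W y).
Proof. by rewrite mulmx_block !(mul0mx, mulmx0, addr0, add0r) !repM. Qed.

Definition rep_sum : rep R G (n + m) := Rep rep_sum1 rep_sumM.

End Sum.

Section Sgn.
Variable chi : sgnchar R G.

Fact rep_sgn1 : (chi 1%g)%:M = 1%:M :> 'M[R]_1.
Proof. by rewrite sgn1. Qed.

Fact rep_sgnM x y :
  (chi (x * y)%g)%:M = (chi x)%:M *m (chi y)%:M :> 'M[R]_1.
Proof. by rewrite sgnM scalar_mxM. Qed.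

Definition rep_sgn : rep R G 1 := Rep rep_sgn1 rep_sgnM.

End Sgn.

Section Induction.
Variables (chi : sgnchar R G) (n : nat) (V0 : rep R (sgnker chi) n).
Variables (s : G) (s_out : chi s = -1).

Definition ker_ext (x : G) : 'M[R]_n :=
  if insub x is Some y then V0 y else 0.

(* The module induced from the kernel of [chi] (of index 2) to [G], in the
   decomposition [(1 (x) V0) (+) (s (x) V0)]: the block [(a, b)] is the extension
   by zero of [V0], evaluated at [a^-1 x b]. *)
Definition ind_mx (x : G) : 'M[R]_(n + n) :=
  block_mx (ker_ext x) (ker_ext (x * s)%g)
           (ker_ext (s^-1 * x)%g) (ker_ext (s^-1 * x * s)%g).

Lemma ker_ext0 x : chi x = -1 -> ker_ext x = 0.
Proof.
move=> xN; rewrite /ker_ext insubF //= xN; apply/negbTE.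
by rewrite eq_sym -subr_eq0 opprK paddr_eq0 ?ler01 // oner_eq0.
Qed.

Lemma ker_extE (y : sgnker chi) : ker_ext (val y) = V0 y.
Proof. by rewrite /ker_ext valK. Qed.

Lemma ker_extM x y :
  chi x = 1 -> chi y = 1 -> ker_ext (x * y)%g = ker_ext x *m ker_ext y.
Proof.
move=> /eqP x1 /eqP y1.
by have := repM V0 (SgnKer x1) (SgnKer y1); rewrite -!ker_extE.
Qed.

Fact ind_mx1 : ind_mx 1%g = 1%:M.
Proof.
rewrite /ind_mx mul1g mulg1 mulVg !(@ker_ext0 s) ?(@ker_ext0 s^-1%g) ?sgnV //.
have -> : ker_ext 1%g = 1%:M; last by rewrite -scalar_mx_block.
by rewrite -(rep1 V0) -ker_extE.
Qed.

Fact ind_mxM x y : ind_mx (x * y)%g = ind_mx x *m ind_mx y.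
Proof.
have sN : chi (s^-1)%g = -1 by rewrite sgnV.
have two a b : ker_ext (a * b)%g =
    ker_ext a *m ker_ext b + ker_ext (a * s)%g *m ker_ext (s^-1 * b)%g.
  have [a1|aN] := sgn_pm1 chi a; have [b1|bN] := sgn_pm1 chi b.
  - rewrite ker_extM // (@ker_ext0 (a * s)%g) ?mul0mx ?addr0 //.
    by rewrite sgnM a1 s_out mul1r.
  - have abN : chi (a * b)%g = -1 by rewrite sgnM a1 bN mul1r.
    have asN : chi (a * s)%g = -1 by rewrite sgnM a1 s_out mul1r.
    by rewrite (ker_ext0 abN) (ker_ext0 bN) (ker_ext0 asN) mulmx0 mul0mx addr0.
  - have abN : chi (a * b)%g = -1 by rewrite sgnM aN b1 mulr1.
    have sbN : chi (s^-1 * b)%g = -1 by rewrite sgnM sN b1 mulr1.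
    by rewrite (ker_ext0 abN) (ker_ext0 aN) (ker_ext0 sbN) mulmx0 mul0mx addr0.
  rewrite (ker_ext0 aN) mul0mx add0r -ker_extM ?sgnM ?aN ?bN ?sN ?s_out.
  - by rewrite mulgA mulgK.
  - by rewrite mulrNN mulr1.
  - by rewrite mulrNN mulr1.
rewrite /ind_mx mulmx_block; congr block_mx.
- exact: two.
- by rewrite -(mulgA x) (two x (y * s)%g) (mulgA s^-1%g).
- by rewrite mulgA (two (s^-1 * x)%g y).
- by rewrite mulgA -(mulgA _ y s) (two (s^-1 * x)%g (y * s)%g) !mulgA.
Qed.

Definition rep_ind : rep R G (n + n) := Rep ind_mx1 ind_mxM.

End Induction.

End Rep.

Definition rep_res (R : realType) (G : groupType) n (chi : sgnchar R G)
    (V : rep R G n) : rep R (sgnker chi) n :=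
  Rep (rep_val := fun x : sgnker chi => V (ker_incl x))
    (rep1 V) (fun x y => repM V (ker_incl x) (ker_incl y)).

Section StandardModule.
Variables (R : realType) (G : groupType) (n : nat).
Variable r : {multiplicative G -> spin R n}.

Fact spin_rep1 : spin_pi (r 1%g) = 1%:M.
Proof.
have -> : r 1%g = 1%g by apply: (mulgI (r 1%g)); rewrite -gmulfM !mulg1.
exact: spin_pi1.
Qed.

Fact spin_repM x y : spin_pi (r (x * y)%g) = spin_pi (r x) *m spin_pi (r y).
Proof. by rewrite gmulfM spin_piM. Qed.

Definition spin_rep : rep R G n := Rep spin_rep1 spin_repM.

End StandardModule.

(* The twist of [r] by [eta] is only formed inside the Clifford algebra, as
   [eta x *: val (r x)]. *)
Section Unacceptable.
Variables (R : realType) (G : groupType).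
Implicit Types (r : {multiplicative G -> spin R 7}) (chi eta psi : sgnchar R G).

Definition unacceptable r eta : Prop :=
  (forall x, exists g : spin R 7,
     val (g * r x * g^-1)%g = eta x *: val (r x))
  /\ ~ (exists g : spin R 7, forall x,
     val (g * r x * g^-1)%g = eta x *: val (r x)).

Definition in_X r psi : Prop :=
  exists g : spin R 7, forall x, val (g * r x * g^-1)%g = psi x *: val (r x).

End Unacceptable.

Definition acceptable (R : realType) (G : groupType)
    (r : {multiplicative G -> spin R 7}) (eta : sgnchar R G) : Prop :=
  ~ unacceptable r eta.

Definition type_III (R : realType) (G : groupType)
    (r : {multiplicative G -> spin R 7}) (chi : sgnchar R G) : Prop :=
  [/\ sgn_nontrivial chi,
      rep_contains (spin_rep r) (rep_sgn chi),
      ~ rep_contains (spin_rep r) (rep_sgn (sgn_triv R G))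
    & exists eta' : sgnchar R G,
        [/\ sgn_nontrivial eta',
            unacceptable r eta'
          & acceptable (r \o @ker_incl R G chi)
              (sgn_pull (@ker_incl R G chi) eta')]].

(* Up to isomorphism, [rep_ind V0 s_out] does not depend on the representative
   [s] of the nontrivial coset. *)
Definition type_IIIa (R : realType) (G : groupType)
    (r : {multiplicative G -> spin R 7}) (eta chi : sgnchar R G) : Prop :=
  [/\ type_III r chi,
      sgn_nontrivial eta,
      ~ in_X r eta
    & exists U : rep R G 6,
        rep_iso (spin_rep r) (rep_sum U (rep_sgn chi)) /\
        exists (V0 : rep R (sgnker chi) 2) (Q' : rep R G 2)
               (s : G) (s_out : chi s = -1),
          [/\ rep_contains (rep_res chi U) V0,
              forall x, \det (V0 x) = eta (ker_incl x),
              forall x, \det (Q' x) = chi x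
            & rep_iso U (rep_sum Q' (rep_ind V0 s_out))]].

Section Alpha.
Variables (R : realType) (D : frame R).

Fact hbar_alphaM (f g : hbar D) :
  det_on (frQ D) (f * g)%g = det_on (frQ D) f * det_on (frQ D) g.
Proof. by case: g => g /= /asboolP[_ gQ _ _]; rewrite det_onM // gQ. Qed.

Fact hbar_alpha_pm1 (f : hbar D) :
  det_on (frQ D) f = 1 \/ det_on (frQ D) f = -1.
Proof.
case: f => f /= /asboolP[_ _ _ <-]; rewrite /perm_sign.
by case: ifP; [left | right].
Qed.

Definition hbar_alpha : sgnchar R (hbar D) :=
  SgnChar hbar_alphaM hbar_alpha_pm1.

Definition inflate (chi : sgnchar R (hbar D)) : sgnchar R (hgrp D) :=
  sgn_pull (@hgrp_hbar R D) chi.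

End Alpha.

(* Main.v *)
Require Import Defs.
From HB Require Import structures.
From mathcomp Require Import all_boot all_order all_algebra.
From mathcomp Require Import boolp reals.
From mathcomp Require Import ring.
From mathcomp Require complex.

(** Fix orthonormal bases of [L], [P], [P'] and [Q]; elements of [H] are then
    block matrices, and [H] consists of all the elements of the spin group
    whose blocks have the right shape and determinants ([hgrp_intro],
    [hgrp_actP], [hgrp_actQ], [hgrp_actL]).

    The inclusion of [H]. For an element [x] of the spin group to be conjugate
    to its opposite, it is enough that its image in SO(7) have the eigenvalues
    1 and -1: if [w] is fixed and [v] is negated, then the Clifford element [w
    v] anticommutes with [x] ([spin_conj_opp]). Every [h] in [H] with [eps h =
    -1] has such eigenvectors: in [P], where it is a reflection, if [h] is in
    [H_0], and in [L] and [Q] otherwise ([eps_conj_each]). A global conjugation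
    multiplying [H] by [eps] would act on [P] and [P'] by a common sign, hence
    would commute with the product of two vectors [p], [p'] of these planes;
    but this product is an element of [H] at which [eps] is -1
    ([eps_not_in_X]). Over [H_0] on the other hand, conjugation by the volume
    element of [P] multiplies by the determinant on [P], that is by [eps]
    ([eps_conj_ker]). The standard module is the sum of [L], which carries
    [alpha], of [Q], and of [P + P'], which is induced from [P] ([rho_decomp]).

    The converse. The standard module is isomorphic to [Q' + Ind V0 + chi].
    The summands may be taken orthogonal ([contains_orth_rep]), and then, by
    polar decomposition of an isomorphism, the isomorphism may be taken
    isometric ([orth_rep_iso]). Composed with the adapted basis and
    corrected by a sign on [L], it lies in SO(7) and lifts to the spin group
    ([spin_lift], which rests on the theorem of Cartan and Dieudonne);
    conjugation by the lift sends [r] into [H], with [chi = alpha \o f], and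
    with [eta = eps \o f] on the kernel of [chi] since both are the
    determinant of [V0] there ([descend_in_basis]). Hence [eta] is [eps \o
    f] or its product with [chi]; in the second case one changes the
    identification of the second plane with [P'] by a reflection, which
    multiplies [eps \o f] by [chi] ([IIIa_factors]). *)

Set Implicit Arguments.
Unset Strict Implicit.
Unset Printing Implicit Defensive.

Import Order.TTheory GRing.Theory Num.Theory.
Local Open Scope ring_scope.

(** * Square roots of Gram matrices *)

Lemma poly_interpolation (K : fieldType) (f : K -> K) (s : seq K) :
  exists p : {poly K}, forall a, a \in s -> p.[a] = f a.
Proof.
elim: s => [|a s [p ps]]; first by exists 0.
have [as_|a_s] := boolP (a \in s).
  by exists p => b; rewrite inE => /orP[/eqP->|]; exact: ps.
pose q := \prod_(b <- s) ('X - b%:P).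
have qa : q.[a] != 0.
  by rewrite -[_ == 0]/(root q a) root_prod_XsubC.
exists (p + ((f a - p.[a]) / q.[a]) *: q) => b.
rewrite inE hornerD hornerZ => /orP[/eqP->|bs].
  by rewrite divfK // addrC subrK.
have /eqP -> : q.[b] == 0 by rewrite -[_ == 0]/(root q b) root_prod_XsubC.
by rewrite mulr0 addr0 ps.
Qed.

Lemma trmx_horner_mx (K : comNzRingType) n (A : 'M[K]_n.+1) (p : {poly K}) :
  (horner_mx A p)^T = horner_mx A^T p.
Proof.
elim/poly_ind: p => [|p c IH]; first by rewrite !rmorph0 trmx0.
rewrite !rmorphD !rmorphM /= !horner_mx_X !horner_mx_C linearD /= tr_scalar_mx.
rewrite -mulmxE trmx_mul IH; congr (_ + _).
exact/esym/comm_horner_mx.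
Qed.

Lemma mulmx_injP (K : fieldType) m n (A : 'M[K]_(m, n)) :
  \rank A = n -> forall p (X Y : 'M_(n, p)), A *m X = A *m Y -> X = Y.
Proof.
move=> Ar p X Y /(congr1 trmx); rewrite !trmx_mul => /row_free_inj XY.
by apply/trmx_inj/XY; rewrite /row_free mxrank_tr Ar.
Qed.

Lemma gram_unit (R : realType) m n (A : 'M[R]_(m, n)) :
  \rank A = n -> A^T *m A \in unitmx.
Proof.
move=> Ar; rewrite -row_free_unit -kermx_eq0; apply/rowV0P => u.
move/sub_kermxP => uA; apply/trmx_inj/(mulmx_injP Ar); rewrite trmx0 mulmx0.
apply: dotvv_eq0; rewrite /dotv trmx_mul trmxK mulmxA -(mulmxA u) uA.
by rewrite mul0mx mxE.
Qed.

Section GramSqrt.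
Variables (R : realType) (C : numClosedFieldType) (c : {rmorphism R -> C}).
Hypothesis conj_c : forall x, (c x)^* = c x.
Hypothesis c_ge0 : forall z : C, 0 <= z -> exists2 x, 0 <= x & z = c x.

(** Over an algebraically closed field the Gram matrix is diagonalized by a
    unitary matrix, with nonnegative eigenvalues; the square root is [p]
    applied to the Gram matrix, for a real polynomial [p] interpolating the
    square roots of the eigenvalues. Being a polynomial in the Gram matrix,
    it commutes with whatever commutes with it. The closure is kept abstract
    so that its operations do not unfold. *)
Lemma gram_sqrt_of_closure m n (A : 'M[R]_(m, n)) :
  \rank A = n -> exists T : 'M[R]_n,
    [/\ T \in unitmx, T^T = T, T *m T = A^T *m A
      & forall X, comm_mx (A^T *m A) X -> comm_mx T X].
Proof.
case: n A => [|n] A Ar.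
  exists 0; split => [|||X _]; try by apply/matrixP => -[].
  by rewrite unitmxE det_mx00 unitr1.
have := gram_unit Ar; set S := A^T *m A => Su.
pose Ac := map_mx c A; pose Sc := map_mx c S.
have ScE : Sc = Ac^T *m Ac by rewrite /Sc /S map_mxM map_trmx.
have cK k l (M : 'M[R]_(k, l)) : map_mx Num.conj (map_mx c M) = map_mx c M.
  by apply/matrixP => i j; rewrite !mxE conj_c.
have Sn : Sc \is normalmx.
  by apply/normalmxP; rewrite /Sc map_trmx cK /S trmx_mul trmxK.
have := orthomx_spectralP Sn; have := spectral_unitarymx Sc.
have := spectral_unit Sc.
set P := spectralmx Sc; set d := spectral_diag Sc => Pu Pun dE.
(* Each eigenvalue is the squared norm of the image of an eigenvector. *)
have d_ge0 i : 0 <= d 0 i.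
  have : diag_mx d = (P *m Ac^T) *m map_mx Num.conj (P *m Ac^T)^T.
    rewrite trmx_mul trmxK map_mxM /Ac cK mulmxA -(mulmxA P) -/Ac -ScE dE.
    rewrite -(invmx_unitary Pun) !mulmxA mulmxV // mul1mx.
    by rewrite -mulmxA mulmxV // mulmx1.
  move/matrixP/(_ i i); rewrite [in X in X = _]mxE eqxx mulr1n => ->.
  rewrite mxE sumr_ge0 // => j _.
  by rewrite [X in _ * X]mxE [X in _ * X^*]mxE mul_conjC_ge0.
have [e e_ge0 de] : exists2 e : 'I_n.+1 -> R, forall i, 0 <= e i
    & forall i, d 0 i = c (e i).
  have d_re i : {x | 0 <= x & d 0 i = c x} by apply/cid2/c_ge0/d_ge0.
  by exists (fun i => s2val (d_re i)) => i; case: (d_re i).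
have [p pE] := poly_interpolation (@Num.sqrt R) [seq e i | i <- enum 'I_n.+1].
pose T := horner_mx S p.
have TT : T *m T = S.
  apply: (map_mx_inj (f := c)); rewrite mulmxE /T -rmorphM /=.
  rewrite map_horner_mx /= -/Sc dE horner_mx_uconjC // horner_mx_diag.
  congr (_ *m diag_mx _ *m _); apply/rowP => i.
  rewrite mxE de horner_map /= hornerM pE ?map_f ?mem_enum //.
  by rewrite -expr2 sqr_sqrtr.
exists T; split => //.
- by move: Su; rewrite -TT unitmx_mul => /andP[].
- by rewrite trmx_horner_mx /S trmx_mul trmxK.
- by move=> X SX; exact: comm_horner_mx.
Qed.

End GramSqrt.

Section ComplexGramSqrt.
Import complex.

Lemma gram_sqrt (R : realType) m n (A : 'M[R]_(m, n)) :
  \rank A = n -> exists T : 'M[R]_n,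
    [/\ T \in unitmx, T^T = T, T *m T = A^T *m A
      & forall X, comm_mx (A^T *m A) X -> comm_mx T X].
Proof.
pose C : numClosedFieldType := complex.complex R.
pose c : {rmorphism R -> C} := complex.real_complex R.
apply: (gram_sqrt_of_closure (c := c)).
  exact: complex.conjc_real.
move=> z z0; exists (complex.Re z).
  by have := z0; rewrite complex.lecE /= => /andP[].
by rewrite [LHS]complex.complexE complex.ger0_Im // mulr0 addr0.
Qed.

End ComplexGramSqrt.

(** * Orthogonal representations *)

Section OrthogonalReps.
Variables (R : realType) (G : groupType).

Definition orth_rep n (V : rep R G n) : Prop :=
  forall x, (V x)^T *m V x = 1%:M.

Fact rep_conj1 n (V : rep R G n) (C : 'M[R]_n) : C \in unitmx ->
  C *m V 1%g *m invmx C = 1%:M.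
Proof. by move=> Cu; rewrite rep1 mulmx1 mulmxV. Qed.

Fact rep_conjM n (V : rep R G n) (C : 'M[R]_n) : C \in unitmx -> forall x y,
  C *m V (x * y)%g *m invmx C =
  (C *m V x *m invmx C) *m (C *m V y *m invmx C).
Proof. by move=> Cu x y; rewrite repM !mulmxA mulmxKV. Qed.

Definition rep_conj n (V : rep R G n) (C : 'M[R]_n) (Cu : C \in unitmx) :
  rep R G n := Rep (rep_conj1 V Cu) (rep_conjM V Cu).

Lemma rep_conj_iso n (V : rep R G n) C (Cu : C \in unitmx) :
  rep_iso V (rep_conj V Cu).
Proof.
exists C, (invmx C); split; rewrite ?mulmxV ?mulVmx // => x /=.
by rewrite mulmxKV.
Qed.

Lemma rep_iso_trans n m k (V : rep R G n) (W : rep R G m) (X : rep R G k) :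
  rep_iso V W -> rep_iso W X -> rep_iso V X.
Proof.
move=> [A [A' [AA' A'A VW]]] [B [B' [BB' B'B WX]]].
exists (B *m A), (A' *m B'); split=> [||x].
- by rewrite mulmxA -(mulmxA B) AA' mulmx1.
- by rewrite mulmxA -(mulmxA A') B'B mulmx1.
- by rewrite -mulmxA VW mulmxA WX mulmxA.
Qed.

Lemma rep_sum_iso n m n' m' (V : rep R G n) (W : rep R G m)
    (V' : rep R G n') (W' : rep R G m') :
  rep_iso V V' -> rep_iso W W' -> rep_iso (rep_sum V W) (rep_sum V' W').
Proof.
move=> [A [A' [AA' A'A VV']]] [B [B' [BB' B'B WW']]].
exists (block_mx A 0 0 B), (block_mx A' 0 0 B').
split=> [||x]; rewrite ?mulmx_block !(mul0mx, mulmx0, addr0, add0r).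
- by rewrite AA' BB' -scalar_mx_block.
- by rewrite A'A B'B -scalar_mx_block.
- by rewrite VV' WW'.
Qed.

Lemma rep_iso_refl n (V : rep R G n) : rep_iso V V.
Proof. by exists 1%:M, 1%:M; split=> [||x]; rewrite !(mulmx1, mul1mx). Qed.

Lemma rep_contains_iso n m k (V : rep R G n) (W : rep R G m) (X : rep R G k) :
  rep_iso V W -> rep_contains W X -> rep_contains V X.
Proof.
move=> [A [A' [AA' A'A VW]]] [B [Br WX]]; exists (A' *m B); split=> [|x].
  rewrite -mxrank_tr trmx_mul mxrankMfree ?mxrank_tr //.
  by apply/row_freeP; exists A^T; rewrite -trmx_mul AA' trmx1.
have VA : V x *m A' = A' *m W x.
  by rewrite -[LHS]mul1mx -A'A !mulmxA -(mulmxA A') VW -!mulmxA AA' mulmx1.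
by rewrite mulmxA VA -mulmxA WX mulmxA.
Qed.

Lemma rep_contains_suml n m k (V : rep R G n) (W : rep R G m) (X : rep R G k) :
  rep_contains V X -> rep_contains (rep_sum V W) X.
Proof.
move=> [A [Ar VX]]; exists (col_mx A 0); split=> [|x].
  by rewrite rank_col_mx0.
by rewrite mul_block_col mul_col_mx !(mul0mx, mulmx0, addr0, add0r) VX.
Qed.

Lemma orth_rep_sum n m (V : rep R G n) (W : rep R G m) :
  orth_rep V -> orth_rep W -> orth_rep (rep_sum V W).
Proof.
move=> Vo Wo x; rewrite /= tr_block_mx mulmx_block !trmx0.
by rewrite !(mul0mx, mulmx0, addr0, add0r) Vo Wo -scalar_mx_block.
Qed.

Lemma orth_rep_sgn (chi : sgnchar R G) : orth_rep (rep_sgn chi).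
Proof.
move=> x; rewrite /= tr_scalar_mx -scalar_mxM.
by case: (sgn_pm1 chi x) => ->; rewrite ?mulrNN mulr1.
Qed.

(** The Gram matrix of an embedding is an invariant positive form;
    conjugating by its square root turns that form into the standard one. *)
Lemma contains_orth_rep n m (E : rep R G m) (V : rep R G n) :
  orth_rep E -> rep_contains E V ->
  exists (C : 'M[R]_n) (Cu : C \in unitmx), orth_rep (rep_conj V Cu).
Proof.
move=> Eo [A [Ar EV]]; have [T [Tu Ts TT _]] := gram_sqrt Ar.
exists T, Tu => x /=; rewrite !trmx_mul trmx_inv Ts.
rewrite !mulmxA -(mulmxA _ T T) TT.
have -> : invmx T *m (V x)^T *m (A^T *m A) *m V x = invmx T *m (A^T *m A).
  rewrite -!mulmxA -EV (mulmxA (V x)^T) -trmx_mul -EV trmx_mul.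
  by rewrite -(mulmxA A^T) (mulmxA (E x)^T) Eo mul1mx.
by rewrite -TT mulKmx // mulmxV.
Qed.

(** The orthogonal factor of the polar decomposition of an intertwiner is
    still an intertwiner, because the positive factor commutes with the
    action. *)
Lemma orth_rep_iso n m (V : rep R G n) (W : rep R G m) :
  orth_rep V -> orth_rep W -> rep_iso V W ->
  exists O : 'M[R]_(m, n),
    [/\ O^T *m O = 1%:M, O *m O^T = 1%:M & forall x, O *m V x = W x *m O].
Proof.
move=> Vo Wo [A [B [AB BA VW]]].
have Ar : \rank A = n.
  have : \rank (B *m A) = n by rewrite BA mxrank1.
  move=> BAr; apply/eqP; rewrite eqn_leq rank_leq_col -{1}BAr.
  exact: mxrankM_maxr.
have [T [Tu Ts TT TC]] := gram_sqrt Ar.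
have VT x : comm_mx T (V x).
  apply: TC; rewrite /comm_mx -mulmxA VW mulmxA.
  have := congr1 trmx (VW x); rewrite !trmx_mul => VWt.
  have -> : A^T *m W x = V x *m A^T; last by rewrite -mulmxA.
  rewrite -[LHS]mul1mx -(mulmx1C (Vo x)) -!mulmxA (mulmxA _^T) VWt.
  by rewrite -mulmxA Wo mulmx1.
have ST : invmx T *m (T *m T) *m invmx T = 1%:M by rewrite mulKmx // mulmxV.
exists (A *m invmx T); split=> [||x].
- by rewrite trmx_mul trmx_inv Ts mulmxA -(mulmxA _ A^T) -TT ST.
- have XA : invmx T *m invmx T *m A^T *m A = 1%:M.
    by rewrite -!mulmxA -TT mulKmx // mulVmx.
  rewrite trmx_mul trmx_inv Ts -AB mulmxA -[LHS]mulmx1 -AB.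
  rewrite -[RHS]mulmx1 -AB -!mulmxA; congr (A *m _).
  by rewrite !mulmxA XA mul1mx -mulmxA AB mulmx1.
- have -> : A *m invmx T *m V x = A *m V x *m invmx T; last first.
    by rewrite VW mulmxA.
  rewrite -!mulmxA; congr (A *m _); apply: (can_inj (mulmxK Tu)).
  by rewrite mulmxKV // -mulmxA -VT mulKmx.
Qed.

End OrthogonalReps.

Section OrthogonalInduction.
Variables (R : realType) (G : groupType) (chi : sgnchar R G) (n : nat).
Variables (s : G) (s_out : chi s = -1).
Implicit Type V : rep R (sgnker chi) n.

Lemma rep_res_iso m k (V : rep R G m) (W : rep R G k) :
  rep_iso V W -> rep_iso (rep_res chi V) (rep_res chi W).
Proof.
by move=> [A [B [AB BA VW]]]; exists A, B; split=> // x; exact: VW.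
Qed.

Lemma ind_mx_in V x : chi x = 1 ->
  ind_mx V s x = block_mx (ker_ext V x) 0 0 (ker_ext V (s^-1 * x * s)%g).
Proof.
move=> x1; rewrite /ind_mx.
by rewrite (ker_ext0 V (x := (x * s)%g)) ?(ker_ext0 V (x := (s^-1 * x)%g))
  ?sgnM ?sgnV ?s_out ?x1 ?mulr1 ?mul1r.
Qed.

Lemma ind_mx_out V x : chi x = -1 ->
  ind_mx V s x = block_mx 0 (ker_ext V (x * s)%g) (ker_ext V (s^-1 * x)%g) 0.
Proof.
move=> xN; rewrite /ind_mx (ker_ext0 _ xN).
by rewrite (ker_ext0 V (x := (s^-1 * x * s)%g)) ?sgnM ?sgnV ?s_out ?xN
  ?mulrNN ?mul1r.
Qed.

Lemma ker_ext_orth V x : orth_rep V -> chi x = 1 ->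
  (ker_ext V x)^T *m ker_ext V x = 1%:M.
Proof. by move=> Vo /eqP x1; have := Vo (SgnKer x1); rewrite -ker_extE. Qed.

Lemma orth_rep_ind V : orth_rep V -> orth_rep (rep_ind V s_out).
Proof.
move=> Vo x; rewrite /rep_ind /=; have [x1|xN] := sgn_pm1 chi x.
  rewrite ind_mx_in // tr_block_mx mulmx_block !trmx0.
  rewrite !(mul0mx, mulmx0, addr0, add0r) !ker_ext_orth -?scalar_mx_block //.
  by rewrite !sgnM sgnV s_out x1 mulr1 mulrNN mul1r.
rewrite ind_mx_out // tr_block_mx mulmx_block !trmx0.
rewrite !(mul0mx, mulmx0, addr0, add0r) !ker_ext_orth -?scalar_mx_block //;
  by rewrite sgnM ?sgnV s_out xN mulrNN mul1r.
Qed.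

Lemma ker_ext_conj V C (Cu : C \in unitmx) x :
  ker_ext (rep_conj V Cu) x = C *m ker_ext V x *m invmx C.
Proof.
by rewrite /ker_ext; case: insubP => [u _ _ //|_]; rewrite mulmx0 mul0mx.
Qed.

Lemma rep_ind_conj_iso V C (Cu : C \in unitmx) :
  rep_iso (rep_ind V s_out) (rep_ind (rep_conj V Cu) s_out).
Proof.
exists (block_mx C 0 0 C), (block_mx (invmx C) 0 0 (invmx C)).
split=> [||x]; rewrite /= ?/ind_mx !mulmx_block.
- by rewrite !(mul0mx, mulmx0, addr0, add0r) !mulmxV // -scalar_mx_block.
- by rewrite !(mul0mx, mulmx0, addr0, add0r) !mulVmx // -scalar_mx_block.
by rewrite !(mul0mx, mulmx0, addr0, add0r) !ker_ext_conj !mulmxKV.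
Qed.

End OrthogonalInduction.

(** * Reflections and the spin group *)

(** Both sides are the determinant of the block matrix [[1, w], [u, 1]],
    eliminated from either corner. *)
Lemma det_sub_outer (K : comNzRingType) n (u : 'cV[K]_n) (w : 'rV[K]_n) :
  \det (1%:M - u *m w) = 1 - (w *m u) 0 0.
Proof.
have : block_mx 1%:M 0 u 1%:M *m block_mx (1%:M : 'M_1) w 0 (1%:M - u *m w) =
       block_mx 1%:M w 0 1%:M *m block_mx (1%:M - w *m u) 0 u 1%:M.
  rewrite !mulmx_block !(mul0mx, mulmx0, addr0, add0r, mulmx1, mul1mx) subrK.
  by rewrite addrC subrK.
move/(congr1 determinant); rewrite !det_mulmx !(det_lblock, det_ublock) !det1.
by rewrite !(mul1r, mulr1) => ->; rewrite det_mx11 !mxE.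
Qed.

Section Reflections.
Variables (R : realType) (n : nat).
Implicit Types (u v w : 'cV[R]_n) (s : seq 'cV[R]_n) (x : spin R n).

Definition refl_mx v : 'M[R]_n := 1%:M - (2 *: v) *m v^T.

Definition refl_prod s : 'M[R]_n := foldr (fun v M => refl_mx v *m M) 1%:M s.

Definition unit_vectors s := {in s, forall v, dotv v v = 1}.

Lemma unit_vectors_cons v s :
  unit_vectors (v :: s) <-> dotv v v = 1 /\ unit_vectors s.
Proof.
split=> [vs|[v1 s1] w]; last by rewrite inE => /orP[/eqP->|/s1].
by split=> [|w ws]; apply: vs; rewrite inE ?eqxx // ws orbT.
Qed.

Lemma refl_mxE v w : refl_mx v *m w = w - (2 * dotv v w) *: v.
Proof.
rewrite mulmxBl mul1mx -!scalemxAl -mulmxA [v^T *m w]mx11_scalar mul_mx_scalar.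
by rewrite scalerA.
Qed.

Lemma det_refl_mx v : dotv v v = 1 -> \det (refl_mx v) = -1.
Proof.
move=> v1; rewrite det_sub_outer -scalemxAr mxE -/(dotv v v) v1 mulr1.
by rewrite -[2]/(1 + 1) opprD addrA subrr add0r.
Qed.

Lemma refl_mxK v : dotv v v = 1 -> refl_mx v *m refl_mx v = 1%:M.
Proof.
move=> v1; have rv : refl_mx v *m v = - v.
  by rewrite refl_mxE v1 mulr1 mulr2n scalerDl scale1r opprD addNKr.
rewrite {2}/refl_mx mulmxBr mulmx1 mulmxA -scalemxAr rv scalerN mulNmx.
by rewrite opprK subrK.
Qed.

Lemma refl_mx_tr v : (refl_mx v)^T = refl_mx v.
Proof.
rewrite /refl_mx linearB /= trmx1 trmx_mul trmxK linearZ /=.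
by rewrite -scalemxAl -scalemxAr.
Qed.

Lemma det_refl_prod s : unit_vectors s -> \det (refl_prod s) = (-1) ^+ size s.
Proof.
elim: s => [|v s IH] /=; first by rewrite det1.
by case/unit_vectors_cons=> v1 s1; rewrite det_mulmx det_refl_mx // IH // exprS.
Qed.

(** In the Clifford algebra, moving [w] across a unit vector [v] reflects it
    along [v] and changes its sign. *)
Lemma prod_clv_clv s w : unit_vectors s ->
  \prod_(v <- s) clv v * clv w =
  (-1) ^+ size s *: (clv (refl_prod s *m w) * \prod_(v <- s) clv v).
Proof.
elim: s => [|v s IH] /=; first by rewrite big_nil mul1mx scale1r mulr1 mul1r.
case/unit_vectors_cons=> v1 s1; rewrite big_cons -mulrA IH // -mulmxA.
set w' := _ *m w; rewrite -scalerAr exprS -scalerA; set X := \prod_(_ <- _) _.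
rewrite scalerA mulrC -scalerA; congr (_ *: _).
rewrite scaleN1r !mulrA -mulNr; congr (_ * X).
rewrite refl_mxE linearB linearZ /= mulrBl -scalerAl clv_sqr v1 scale1r.
by rewrite -clvM opprB addrK.
Qed.

Lemma spin_pi_prod x s : unit_vectors s -> ~~ odd (size s) ->
  val x = \prod_(v <- s) clv v -> spin_pi x = refl_prod s.
Proof.
move=> s1 so xs; apply/matrixP => i j.
suff /colP/(_ i) : col j (spin_pi x) = col j (refl_prod s) by rewrite !mxE.
rewrite !colE; apply: clv_inj; rewrite spin_piP xs prod_clv_clv //.
by rewrite -signr_odd (negbTE so) scale1r -mulrA -xs spin_valK mulr1.
Qed.

Lemma det_spin_pi x : \det (spin_pi x) = 1.
Proof.
have [s [so s1 xs]] : is_spin (val x) by case: x => x /= /asboolP.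
by rewrite (spin_pi_prod s1) // det_refl_prod // -signr_odd (negbTE so).
Qed.

Lemma spin_pi_orth x : (spin_pi x)^T *m spin_pi x = 1%:M.
Proof.
apply/matrixP => i j; have := spin_pi_dot x (delta_mx i 0) (delta_mx j 0).
rewrite /dotv trmx_mul mulmxA -(mulmxA _ _ (spin_pi x)) -mulmxA.
rewrite trmx_delta -rowE -colE !mxE => /= ->.
rewrite (bigD1 i) //= big1 ?addr0 => [|k /negbTE ki]; rewrite !mxE !eqxx ?ki;
  by rewrite ?mul1r ?mul0r ?andbT.
Qed.

Lemma dotv_scale (a : R) u v : dotv (a *: u) v = a * dotv u v.
Proof. by rewrite /dotv linearZ -scalemxAl mxE. Qed.

Lemma dotv_ge0 u : 0 <= dotv u u.
Proof. by rewrite dotvE sumr_ge0 // => i _; rewrite -expr2 sqr_ge0. Qed.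

(** The reflection along the normalized difference [u - v]. *)
Lemma refl_exchange u v : dotv u u = dotv v v -> u != v ->
  exists2 d, dotv d d = 1 &
    refl_mx d *m u = v /\ forall w, dotv u w = dotv v w -> refl_mx d *m w = w.
Proof.
move=> uv u_v; pose N := dotv (u - v) (u - v).
have N0 : N != 0.
  by apply: contraNneq u_v => /dotvv_eq0/eqP; rewrite subr_eq0.
have NE : N = 2 * dotv (u - v) u.
  rewrite /N dotvBl !(dotvC _ (u - v)) !dotvBl -uv (dotvC v u).
  by rewrite mulr_natl mulr2n opprB.
have N2 : (Num.sqrt N)^-1 * (Num.sqrt N)^-1 = N^-1.
  by rewrite -invfM -expr2 sqr_sqrtr // dotv_ge0.
exists ((Num.sqrt N)^-1 *: (u - v)).
  by rewrite dotv_scale dotvC dotv_scale mulrA N2 mulVf.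
have reflE w :
    refl_mx ((Num.sqrt N)^-1 *: (u - v)) *m w =
    w - (2 * dotv (u - v) w / N) *: (u - v).
  by rewrite refl_mxE dotv_scale scalerA -N2; congr (_ - _ *: _); ring.
split=> [|w uvw]; rewrite reflE; first by rewrite -NE divff // scale1r subKr.
by rewrite dotvBl uvw subrr mulr0 mul0r scale0r subr0.
Qed.

(** Cartan and Dieudonne: reflections bring the images of the basis vectors
    back to their places one at a time, the reflection exchanging [O e_k]
    and [e_k] fixing the vectors [e_i] that are already in place, as these
    are orthogonal to both. *)
Lemma orth_refl_prod (O : 'M[R]_n) : O^T *m O = 1%:M ->
  exists2 s, unit_vectors s & O = refl_prod s.
Proof.
pose e (i : 'I_n) : 'cV[R]_n := delta_mx i 0.
have dot_mul (A : 'M[R]_n) u v : A^T *m A = 1%:M ->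
    dotv (A *m u) (A *m v) = dotv u v.
  by move=> Ao; rewrite /dotv trmx_mul mulmxA -(mulmxA u^T) Ao mulmx1.
have dot_e i j : dotv (e i) (e j) = (i == j)%:R.
  by rewrite /dotv /e trmx_delta -rowE !mxE eqxx andbT.
(* [m] basis vectors are already fixed, [k] are left to be treated. *)
suff: forall k m, (m + k = n)%N -> forall A : 'M[R]_n, A^T *m A = 1%:M ->
    (forall i : 'I_n, (i < m)%N -> A *m e i = e i) ->
    exists2 s, unit_vectors s & A = refl_prod s.
  by move=> /(_ n 0%N (add0n n) O) H Oo; apply: H.
elim=> [|k IH] m mkn A Ao Ae.
  exists [::] => //=; apply/matrixP => i j.
  have jm : (j < m)%N by rewrite addn0 in mkn; rewrite mkn.
  have /matrixP/(_ i 0) := Ae j jm.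
  by rewrite -colE !mxE eqxx andbT => ->.
have mn : (m < n)%N by rewrite -mkn -addSnnS leq_addr.
pose j := Ordinal mn; rewrite -addSnnS in mkn.
have step B : B *m e j = e j ->
    (forall i : 'I_n, (i < m)%N -> B *m e i = e i) ->
    forall i : 'I_n, (i < m.+1)%N -> B *m e i = e i.
  move=> Bj Bi i; rewrite ltnS leq_eqVlt => /orP[/eqP ij|]; last exact: Bi.
  by have -> : i = j by exact: val_inj.
have [Aj|Aj] := eqVneq (A *m e j) (e j).
  by apply: (IH _ mkn) => //; exact: step.
have [|d d1 [dAj dw]] := refl_exchange _ Aj; first by rewrite dot_mul.
have dd := refl_mxK d1.
have [|i im|s s1 dAs] := IH _ mkn (refl_mx d *m A).
- by rewrite trmx_mul refl_mx_tr mulmxA -(mulmxA _ _ (refl_mx d)) dd mulmx1.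
- apply: step i im; first by rewrite -mulmxA.
  move=> i im; rewrite -mulmxA Ae // dw // -{1}(Ae i im) dot_mul //.
- exists (d :: s); first exact/unit_vectors_cons.
  by rewrite /= -dAs mulmxA dd mul1mx.
Qed.

(** An isometry of determinant 1 is a product of an even number of
    reflections. *)
Lemma spin_lift (O : 'M[R]_n) : O^T *m O = 1%:M -> \det O = 1 ->
  exists x : spin R n, spin_pi x = O.
Proof.
move=> /orth_refl_prod[s s1 ->]; rewrite det_refl_prod // -signr_odd => so.
have {}so : ~~ odd (size s).
  apply/negP => os; move: so; rewrite os expr1 => /eqP.
  by rewrite eq_sym -subr_eq0 opprK paddr_eq0 ?ler01 // oner_eq0.
have xs : `[< is_spin (\prod_(v <- s) clv v) >] by apply/asboolP; exists s.
by exists (Spin xs); apply: spin_pi_prod.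
Qed.

Lemma spin_pair u v : dotv u u = 1 -> dotv v v = 1 ->
  exists2 x : spin R n, val x = clv u * clv v &
    spin_pi x = refl_mx u *m refl_mx v.
Proof.
move=> u1 v1; have s1 : unit_vectors [:: u; v].
  by apply/unit_vectors_cons; split=> // w; rewrite inE => /eqP->.
have xs : `[< is_spin (clv u * clv v) >].
  by apply/asboolP; exists [:: u; v]; rewrite big_cons big_seq1.
have xE : val (Spin xs) = \prod_(w <- [:: u; v]) clv w.
  by rewrite big_cons big_seq1.
by exists (Spin xs) => //; rewrite (spin_pi_prod s1 _ xE) //= mulmx1.
Qed.

Lemma clv_spin x v w : spin_pi x *m v = w -> val x * clv v = clv w * val x.
Proof. by move=> <-; rewrite spin_piP -mulrA spin_valVK mulr1. Qed.

Lemma spin_val_conj (g x : spin R n) (a : R) :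
  val (g * x * g^-1)%g = a *: val x <-> val g * val x = a *: (val x * val g).
Proof.
rewrite !spin_valM scalerAl; split=> [<-|->].
  by rewrite -!mulrA spin_valVK mulr1.
by rewrite -mulrA spin_valK mulr1.
Qed.

(** If [w] is fixed by [x] and [v] is negated, then in the Clifford algebra
    [w] commutes with [x] and [v] anticommutes with it, hence so does [w v]. *)
Lemma spin_conj_opp x v w : v != 0 -> w != 0 ->
  spin_pi x *m v = - v -> spin_pi x *m w = w ->
  exists g : spin R n, val (g * x * g^-1)%g = - val x.
Proof.
have unit u : u != 0 -> exists2 a : R, a != 0 & dotv (a *: u) (a *: u) = 1.
  move=> u0; have N0 : dotv u u != 0.
    by apply: contraNneq u0 => /dotvv_eq0 ->.
  exists (Num.sqrt (dotv u u))^-1; rewrite ?invr_eq0 ?sqrtr_eq0.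
    by rewrite -ltNge lt_neqAle eq_sym N0 dotv_ge0.
  rewrite dotv_scale dotvC dotv_scale mulrA -invfM -expr2 sqr_sqrtr ?mulVf //.
  exact: dotv_ge0.
move=> /unit[a _ v1] /unit[b _ w1] xv xw.
have [g gE _] := spin_pair w1 v1; exists g.
rewrite -scaleN1r; apply/spin_val_conj; rewrite gE.
have wx : val x * clv (b *: w) = clv (b *: w) * val x.
  by apply: clv_spin; rewrite -scalemxAr xw.
have vx : val x * clv (a *: v) = - (clv (a *: v) * val x).
  by rewrite -mulNr -linearN -scalerN; apply: clv_spin; rewrite -scalemxAr xv.
by rewrite scaleN1r mulrA wx -(mulrA _ (val x)) vx mulrN opprK mulrA.
Qed.

End Reflections.

(** * Orthonormal bases adapted to a frame *)

(** [det_on] is computed in the basis [vbasis U]; it is invariant under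
    change of basis. *)
Lemma det_on_basis (K : fieldType) (vT : vectType K) (U : {vspace vT}) k
    (X : 'I_k -> vT) (M : 'M[K]_k) (f : 'End(vT)) :
  \dim U = k -> (forall j, X j \in U) ->
  (forall c : 'cV[K]_k, \sum_j c j 0 *: X j = 0 -> c = 0) ->
  (forall j, f (X j) = \sum_i M i j *: X i) ->
  det_on U f = \det M.
Proof.
move=> Uk; case: k / Uk X M => X M XU Xfree fX.
pose b := vbasis U; pose N := \matrix_(i, j) coord b i (X j).
have XE j : X j = \sum_i N i j *: b`_i.
  by rewrite {1}(coord_vbasis (XU j)); apply: eq_bigr => i _; rewrite mxE.
have Nu : \det N != 0.
  rewrite -unitfE -unitmxE -unitmx_tr -row_free_unit -kermx_eq0.
  apply/rowV0P => u /sub_kermxP uN; apply/trmx_inj; rewrite trmx0.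
  apply: Xfree; under eq_bigr => j _ do rewrite XE scaler_sumr.
  rewrite exchange_big big1 //= => i _.
  under eq_bigr => j _ do rewrite scalerA.
  rewrite -scaler_suml; have /rowP/(_ i) := uN; rewrite !mxE => uNi.
  by under eq_bigr => j _ do [have -> : u^T j 0 * N i j = u 0 j * N^T j i
    by rewrite !mxE]; rewrite uNi scale0r.
apply: (mulIf Nu); rewrite [RHS]mulrC -!det_mulmx; congr (\det _).
apply/matrixP => l j; transitivity (coord b l (f (X j))).
  rewrite [in RHS]XE !linear_sum mxE; apply: eq_bigr => i _.
  by rewrite !linearZ !mxE mulrC.
rewrite fX linear_sum mxE; apply: eq_bigr => i _.
by rewrite !linearZ !mxE mulrC.
Qed.

(** Dividing the matrix of any basis by the square root of its Gram matrix
    makes it orthonormal. *)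
Lemma vspace_onb (R : realType) m k (W : {vspace 'cV[R]_m}) : \dim W = k ->
  exists2 B : 'M[R]_(m, k), B^T *m B = 1%:M &
    forall v, v \in W <-> exists a : 'cV[R]_k, v = B *m a.
Proof.
move=> <-; pose b := vbasis W.
pose A : 'M[R]_(m, \dim W) := \matrix_(i, j) b`_j i 0.
have AE a : A *m a = \sum_j a j 0 *: b`_j.
  apply/colP => i; rewrite mxE summxE; apply: eq_bigr => j _.
  by rewrite !mxE mulrC.
have Ar : \rank A = \dim W.
  rewrite -mxrank_tr; apply/eqP; rewrite -/(row_free _) -kermx_eq0.
  apply/rowV0P => u /sub_kermxP uA; apply/trmx_inj; rewrite trmx0.
  have : A *m u^T = 0 by apply: trmx_inj; rewrite trmx_mul trmxK uA trmx0.
  rewrite AE => u0; apply/colP => j; rewrite [RHS]mxE.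
  by have /freeP/(_ (fun j => u^T j 0) u0 j) := basis_free (vbasisP W).
have [T [Tu Ts TT _]] := gram_sqrt Ar.
exists (A *m invmx T) => [|v].
  by rewrite trmx_mul trmx_inv Ts mulmxA -(mulmxA _ A^T) -TT mulKmx // mulmxV.
split=> [vW|[a ->]]; last first.
  rewrite -mulmxA AE memv_suml // => j _; rewrite memvZ // vbasis_mem //.
  by rewrite mem_nth ?size_tuple.
exists (T *m \col_j coord b j v); rewrite mulmxA mulmxKV // AE.
by rewrite {1}(coord_vbasis vW); apply: eq_bigr => j _; rewrite mxE.
Qed.

Lemma det_swap_blocks (K : comNzRingType) n (A B : 'M[K]_n) :
  \det (block_mx 0 A B 0) = (-1) ^+ n * (\det A * \det B).
Proof.
pose J : 'M[K]_(n + n) := block_mx 0 1%:M 1%:M 0.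
have -> : block_mx 0 A B 0 = J *m block_mx B 0 0 A.
  by rewrite mulmx_block !(mul0mx, mulmx0, mul1mx, addr0, add0r).
have JE : J = block_mx 1%:M 1%:M 0 1%:M *m block_mx (- 1%:M) 0 1%:M 1%:M
    *m block_mx 1%:M (- 1%:M) 0 1%:M.
  rewrite !mulmx_block !(mul0mx, mulmx0, mul1mx, mulmx1, addr0, add0r).
  by rewrite addNr mul0mx add0r.
rewrite det_mulmx JE !det_mulmx !(det_ublock, det_lblock) !det1 !mulr1 !mul1r.
by rewrite -scaleN1r detZ det1 mulr1 (mulrC (\det A)).
Qed.

Lemma trmx_mul_eq0 (K : comNzRingType) m k l (X : 'M[K]_(m, k))
    (Y : 'M[K]_(m, l)) : X^T *m Y = 0 -> Y^T *m X = 0.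
Proof. by move=> XY; apply: trmx_inj; rewrite trmx_mul trmxK XY trmx0. Qed.

(** A square matrix may come as a block matrix whose two dimensions are
    equal without being the same expression, as [7] and [2 + (2 + 2) + 1]. *)
Lemma mulmx1C_eq (K : comUnitRingType) m n (A : 'M[K]_(m, n)) B : m = n ->
  A *m B = 1%:M -> B *m A = 1%:M.
Proof. by move=> mn; case: n / mn A B => A B; exact: mulmx1C. Qed.

Lemma det_conj_mx (K : comUnitRingType) m n (A : 'M[K]_(m, n)) B X : m = n ->
  B *m A = 1%:M -> \det (A *m X *m B) = \det X.
Proof.
move=> mn; case: n / mn A B X => A B X BA.
by rewrite !det_mulmx mulrC mulrA -det_mulmx BA det1 mul1r.
Qed.

Section AdaptedBasis.
Variables (R : realType) (D : frame R).
Local Notation F := (frF D).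
Implicit Types (U V : {vspace subvs_of F}) (x : spin_stab (frL D)).

(** Bases of subspaces of [F] are kept as matrices over the ambient space,
    so that isometries of [F] and of the whole space are handled by matrix
    products. *)
Definition onb_of U k (B : 'M[R]_(7, k)) : Prop :=
  [/\ B^T *m B = 1%:M, forall a : 'cV_k, B *m a \in F
    & forall u, u \in U <-> exists a : 'cV_k, vsval u = B *m a].

Lemma onb_of_exists U k : \dim U = k -> exists B : 'M_(7, k), onb_of U B.
Proof.
move=> Uk; pose i : 'Hom(subvs_of F, 'cV[R]_7) := linfun vsval.
have [|B BB BU] := @vspace_onb R 7 k (i @: U)%VS.
  rewrite -Uk; apply: limg_dim_eq; apply/eqP; rewrite -subv0.
  apply/subvP => u; rewrite memv_cap memv_ker lfunE /= => /andP[_ /eqP u0].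
  by rewrite memv0; apply/eqP/val_inj.
exists B; split=> // [a|u].
  have /memv_imgP[u _ ->] : B *m a \in (i @: U)%VS by apply/BU; exists a.
  by rewrite lfunE subvsP.
rewrite -BU; split=> [uU|/memv_imgP[v vU]].
  by rewrite -[vsval u]lfunE memv_img.
by rewrite lfunE => /val_inj->.
Qed.

Lemma onb_of_col U k (B : 'M_(7, k)) : onb_of U B ->
  forall a : 'cV_k, exists2 u, u \in U & vsval u = B *m a.
Proof.
move=> [_ BF BU] a; exists (vsproj F (B *m a)); last by rewrite vsprojK.
by apply/BU; exists a; rewrite vsprojK.
Qed.

Lemma mulmx_onbK m k n (B : 'M[R]_(m, k)) (a : 'M_(k, n)) :
  B^T *m B = 1%:M -> B^T *m (B *m a) = a.
Proof. by move=> BB; rewrite mulmxA BB mul1mx. Qed.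

Lemma restrFE x (u : subvs_of F) :
  vsval (isom_val (restrF x) u) = spin_pi x *m vsval u.
Proof. exact (restr_lfunE (@frLF_orth R D) (frLF_full D) x u). Qed.

Lemma restrF_img x U V k (B B' : 'M_(7, k)) : onb_of U B -> onb_of V B' ->
  (isom_val (restrF x) @: U)%VS = V ->
  spin_pi x *m B = B' *m (B'^T *m spin_pi x *m B).
Proof.
move=> BU [B'B' _ B'V] xU; apply/matrixP => i j.
have [u uU uB] := onb_of_col BU (delta_mx j 0).
have : isom_val (restrF x) u \in V by rewrite -xU memv_img.
case/B'V => a; rewrite restrFE uB => xa.
have /matrixP/(_ i 0) : spin_pi x *m B *m delta_mx j 0 =
   B' *m (B'^T *m spin_pi x *m B) *m (delta_mx j 0 : 'cV_k).
  by rewrite -!mulmxA xa mulmx_onbK.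
by rewrite -!colE !mxE.
Qed.

Lemma restrF_imgP x U V k (B B' : 'M_(7, k)) a : onb_of U B -> onb_of V B' ->
  \dim U = \dim V -> spin_pi x *m B = B' *m a ->
  (isom_val (restrF x) @: U)%VS = V.
Proof.
move=> [_ _ BU] [_ _ B'V] UV xB; apply/eqP; rewrite eqEdim; apply/andP; split.
  apply/subvP => _ /memv_imgP[u /BU[c uc] ->]; apply/B'V; exists (a *m c).
  by rewrite restrFE uc !mulmxA xB.
rewrite -UV limg_dim_eq //; apply/eqP; rewrite -subv0; apply/subvP => u.
rewrite memv_cap => /andP[_]; have /eqP-> := isom_lker0 (restrF x).
by [].
Qed.

Lemma restrF_det x U k (B : 'M_(7, k)) a : onb_of U B -> \dim U = k ->
  spin_pi x *m B = B *m a -> det_on U (restrF x) = \det a.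
Proof.
move=> BU Uk xB; have [BB BF _] := BU.
pose X j := vsproj F (B *m delta_mx j 0).
have XE j : vsval (X j) = B *m delta_mx j 0 by rewrite vsprojK.
have sumX (c : 'cV_k) : vsval (\sum_j c j 0 *: X j) = B *m c.
  rewrite linear_sum /= [c in RHS]matrix_sum_delta mulmx_sumr.
  by apply: eq_bigr => j _; rewrite big_ord1 -scalemxAr -XE.
apply: (@det_on_basis _ _ _ _ X) => // [j|c|j].
- by have [u uU uE] := onb_of_col BU (delta_mx j 0); rewrite /X -uE vsvalK.
- by move=> c0; rewrite -[c](mulmx_onbK _ BB) -sumX c0 !linear0.
- have := restrFE x (X j); rewrite XE mulmxA xB -mulmxA -colE -sumX => xXj.
  by apply/val_inj/(etrans xXj)/(congr1 vsval)/eq_bigr => i _; rewrite mxE.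
Qed.

Record adapted_basis := AdaptedBasis {
  bP : 'M[R]_(7, 2); bP' : 'M[R]_(7, 2); bQ : 'M[R]_(7, 2); bL : 'M[R]_(7, 1);
  bP_onb : onb_of (frP D) bP;
  bP'_onb : onb_of (frP' D) bP';
  bQ_onb : onb_of (frQ D) bQ;
  bL_unit : bL^T *m bL = 1%:M;
  bL_mem : forall v, v \in frL D <-> exists a : 'cV_1, v = bL *m a
}.

Lemma adapted_basis_exists : inhabited adapted_basis.
Proof.
have [BP HP] := onb_of_exists (frP_dim D).
have [BP' HP'] := onb_of_exists (frP'_dim D).
have [BQ HQ] := onb_of_exists (frQ_dim D).
have [BL HL LL] := vspace_onb (frL_dim D).
by constructor; exact: (AdaptedBasis HP HP' HQ HL LL).
Qed.

Lemma onb_orth (k l : nat) (B : 'M[R]_(7, k)) (B' : 'M[R]_(7, l)) :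
  (forall a b, dotv (B *m a) (B' *m b) = 0) -> B^T *m B' = 0.
Proof.
move=> BB'; apply/matrixP => i j; have := BB' (delta_mx i 0) (delta_mx j 0).
rewrite /dotv trmx_mul mulmxA -(mulmxA _ _ B') -mulmxA trmx_delta -rowE -colE.
by rewrite !mxE.
Qed.

Variable B : adapted_basis.

Let FF U V k l (X : 'M_(7, k)) (Y : 'M_(7, l)) : onb_of U X -> onb_of V Y ->
  (forall u v, u \in U -> v \in V -> dotv (vsval u) (vsval v) = 0) ->
  X^T *m Y = 0.
Proof.
move=> XU YV UV; apply: onb_orth => a b.
have [u uU <-] := onb_of_col XU a; have [v vV <-] := onb_of_col YV b.
exact: UV.
Qed.

Let LF U k (X : 'M_(7, k)) : onb_of U X -> (bL B)^T *m X = 0.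
Proof.
move=> XU; apply: onb_orth => a b; have [u uU <-] := onb_of_col XU b.
by apply: (frLF_orth (f := D)); [apply/(bL_mem B); exists a | exact: subvsP].
Qed.

Lemma bPP' : (bP B)^T *m bP' B = 0.
Proof. exact: FF (bP_onb B) (bP'_onb B) (@frPP'_orth R D). Qed.
Lemma bPQ : (bP B)^T *m bQ B = 0.
Proof. exact: FF (bP_onb B) (bQ_onb B) (@frPQ_orth R D). Qed.
Lemma bP'Q : (bP' B)^T *m bQ B = 0.
Proof. exact: FF (bP'_onb B) (bQ_onb B) (@frP'Q_orth R D). Qed.
Lemma bLP : (bL B)^T *m bP B = 0. Proof. exact: LF (bP_onb B). Qed.
Lemma bLP' : (bL B)^T *m bP' B = 0. Proof. exact: LF (bP'_onb B). Qed.
Lemma bLQ : (bL B)^T *m bQ B = 0. Proof. exact: LF (bQ_onb B). Qed.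

(** The order of the blocks is that of the module [Q' + Ind V0 + chi]. *)
Definition frame_mx : 'M[R]_(7, 2 + (2 + 2) + 1) :=
  row_mx (row_mx (bQ B) (row_mx (bP B) (bP' B))) (bL B).

Lemma frame_mx_orth : frame_mx^T *m frame_mx = 1%:M.
Proof.
have [PP _ _] := bP_onb B; have [P'P' _ _] := bP'_onb B.
have [QQ _ _] := bQ_onb B.
rewrite /frame_mx !tr_row_mx !mul_col_row !mul_col_mx !mul_mx_row.
rewrite PP P'P' QQ bL_unit bPP' bPQ bP'Q bLP bLP' bLQ.
rewrite (trmx_mul_eq0 bPP') (trmx_mul_eq0 bPQ) (trmx_mul_eq0 bP'Q).
rewrite (trmx_mul_eq0 bLP) (trmx_mul_eq0 bLP') (trmx_mul_eq0 bLQ).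
rewrite !row_mx0 !col_mx0.
by rewrite -!scalar_mx_block.
Qed.

Lemma bPP'_onb : onb_of (frP D + frP' D) (row_mx (bP B) (bP' B)).
Proof.
have [PP PF PU] := bP_onb B; have [P'P' P'F P'U] := bP'_onb B; split=> [|a|u].
- rewrite tr_row_mx mul_col_row PP P'P' bPP' (trmx_mul_eq0 bPP').
  by rewrite -scalar_mx_block.
- by rewrite -[a]vsubmxK mul_row_col rpredD.
- split=> [/memv_addP[v /PU[a va] [w /P'U[b wb] ->]]|[a]].
    by exists (col_mx a b); rewrite mul_row_col -va -wb.
  have [v vP vE] := onb_of_col (bP_onb B) (usubmx a).
  have [w wP wE] := onb_of_col (bP'_onb B) (dsubmx a).
  rewrite -[a]vsubmxK mul_row_col -vE -wE => uE.
  by have -> : u = v + w; [exact/val_inj | exact: memv_add].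
Qed.

End AdaptedBasis.

(** * The group H in an adapted basis *)

Section HgrpInBasis.
Variables (R : realType) (D : frame R) (B : adapted_basis D).
Local Notation alpha := (inflate (hbar_alpha D)).
Local Notation bP := (bP B).
Local Notation bP' := (bP' B).
Local Notation bQ := (bQ B).
Local Notation bL := (bL B).
Local Notation pi := (@spin_pi R 7).
Implicit Types (h : hgrp D) (x : spin R 7).

Lemma pi_coef_orth x k (X Y : 'M[R]_(7, k)) a : X^T *m X = 1%:M ->
  Y^T *m Y = 1%:M -> pi x *m X = Y *m a -> a^T *m a = 1%:M.
Proof.
move=> XX YY xX; have : (pi x *m X)^T *m (pi x *m X) = 1%:M.
  by rewrite trmx_mul mulmxA -(mulmxA X^T) spin_pi_orth mulmx1.
by rewrite xX trmx_mul mulmxA -(mulmxA a^T) YY mulmx1.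
Qed.

Lemma bP_orth : bP^T *m bP = 1%:M. Proof. by case: (bP_onb B). Qed.
Lemma bP'_orth : bP'^T *m bP' = 1%:M. Proof. by case: (bP'_onb B). Qed.
Lemma bQ_orth : bQ^T *m bQ = 1%:M. Proof. by case: (bQ_onb B). Qed.

Lemma spin_frame_lift (X : 'M[R]_(2 + (2 + 2) + 1)) :
  X^T *m X = 1%:M -> \det X = 1 ->
  exists x, pi x *m frame_mx B = frame_mx B *m X.
Proof.
move=> XX X1; have BB := frame_mx_orth B.
have BBt : frame_mx B *m (frame_mx B)^T = 1%:M by exact: mulmx1C_eq BB.
have [||x xE] := @spin_lift R 7 (frame_mx B *m X *m (frame_mx B)^T).
- rewrite !trmx_mul trmxK !mulmxA -(mulmxA _ _ (frame_mx B)) BB mulmx1.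
  by rewrite -(mulmxA _ X^T) XX mulmx1.
- by rewrite det_conj_mx.
by exists x; rewrite xE -mulmxA BB mulmx1.
Qed.

Lemma dimPP' : \dim (frP D + frP' D) = (2 + 2)%N.
Proof.
rewrite dimv_disjoint_sum ?frP_dim ?frP'_dim //; apply/eqP; rewrite -subv0.
apply/subvP => u; rewrite memv_cap memv0 => /andP[uP uP'].
by apply/eqP/val_inj/dotvv_eq0/(frPP'_orth uP uP').
Qed.

Lemma hgrp_alphaE h q : pi h *m bQ = bQ *m q -> alpha h = \det q.
Proof. exact: restrF_det (bQ_onb B) (frQ_dim D). Qed.

Lemma hgrp_in_hbar h : in_hbar (restrF h).
Proof. by case: h => x /= /asboolP. Qed.

Lemma hgrp_actQ h : exists2 q, pi h *m bQ = bQ *m q & \det q = alpha h.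
Proof.
have [_ hQ _ _] := hgrp_in_hbar h.
have hE := restrF_img (bQ_onb B) (bQ_onb B) hQ.
by exists (bQ^T *m pi h *m bQ) => //; rewrite (hgrp_alphaE hE).
Qed.

Lemma hgrp_actP (eps : sgnchar R (hbar D)) :
  (forall f : hbar D, hbar_alpha D f = 1 ->
     eps f = det_on (frP D) f /\ eps f = det_on (frP' D) f) ->
  forall h, alpha h = 1 -> exists a a',
    [/\ pi h *m bP = bP *m a, pi h *m bP' = bP' *m a',
        \det a = inflate eps h & \det a' = inflate eps h].
Proof.
move=> epsE h h1; have [hP hQ hd hs] := hgrp_in_hbar h.
have {hP} [hP hP'] : (isom_val (restrF h) @: frP D)%VS = frP D /\
    (isom_val (restrF h) @: frP' D)%VS = frP' D.
  case: hP => // -[hP hP']; have : perm_sign (restrF h) = 1 by rewrite hs.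
  rewrite /perm_sign hP eq_sym (negbTE (@frPP'_neq R D)) => /eqP.
  by rewrite eq_sym -subr_eq0 opprK paddr_eq0 ?ler01 // oner_eq0.
have aE := restrF_img (bP_onb B) (bP_onb B) hP.
have a'E := restrF_img (bP'_onb B) (bP'_onb B) hP'.
have [eP eP'] := epsE (hgrp_hbar h) h1.
exists (bP^T *m pi h *m bP), (bP'^T *m pi h *m bP'); split=> //.
  by rewrite [RHS]eP; apply/esym/(restrF_det (bP_onb B) (frP_dim D)).
by rewrite [RHS]eP'; apply/esym/(restrF_det (bP'_onb B) (frP'_dim D)).
Qed.

(** An element of the spin group has determinant 1 on the standard module,
    and one of [H] has determinant 1 on [P + P'], so its determinants on [L]
    and [Q] have product 1. *)
Lemma hgrp_actL h : pi h *m bL = alpha h *: bL.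
Proof.
have [_ _ hd _] := hgrp_in_hbar h; have [q hQ q1] := hgrp_actQ h.
have PP'F := bPP'_onb B.
have hPP' : (isom_val (restrF h) @: (frP D + frP' D))%VS = (frP D + frP' D)%VS.
  rewrite limgD.
  by have [[[-> ->]|[-> ->]] _ _ _] := hgrp_in_hbar h; rewrite // addvC.
have wE := restrF_img PP'F PP'F hPP'; set w := _ *m _ *m _ in wE.
have w1 : \det w = 1 by rewrite -(restrF_det PP'F dimPP' wE).
have [l lE] : exists l : 'cV_1, pi h *m bL = bL *m l.
  apply/(bL_mem B); have /eqP hL : (spin_lfun h @: frL D)%VS == frL D.
    by case: (hgrp_val h).
  have : spin_lfun h bL \in (spin_lfun h @: frL D)%VS.
    by apply: memv_img; apply/(bL_mem B); exists 1%:M; rewrite mulmx1.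
  by rewrite hL lfunE.
have hB : pi h *m frame_mx B =
    frame_mx B *m block_mx (block_mx q 0 0 w) 0 0 l.
  rewrite /frame_mx !mul_row_block !(mulmx0, addr0, add0r).
  by rewrite !mul_mx_row hQ lE -wE mul_mx_row.
have al := det_spin_pi h.
have hE : pi h =
    frame_mx B *m block_mx (block_mx q 0 0 w) 0 0 l *m (frame_mx B)^T.
  by rewrite -hB -mulmxA (mulmx1C_eq _ (frame_mx_orth B)) ?mulmx1.
rewrite hE det_conj_mx ?frame_mx_orth // !det_ublock w1 q1 mulr1 in al.
rewrite lE [l]mx11_scalar mul_mx_scalar; congr (_ *: _).
move: al; rewrite [l]mx11_scalar det_scalar1 mxE eqxx mulr1n.
by case: (sgn_pm1 alpha h) => ->; rewrite ?mul1r // mulN1r => <-; rewrite opprK.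
Qed.

(** The action on [P + P'] has determinant [det a * det a'] in both cases:
    two planes are exchanged by an even permutation of the basis. *)
Lemma hgrp_intro x a a' q (c : R) :
  (c = 1 /\ pi x *m bP = bP *m a /\ pi x *m bP' = bP' *m a') \/
  (c = -1 /\ pi x *m bP = bP' *m a /\ pi x *m bP' = bP *m a') ->
  pi x *m bQ = bQ *m q -> pi x *m bL = c *: bL ->
  \det a * \det a' = 1 -> \det q = c ->
  exists2 h, hgrp_incl h = x & alpha h = c.
Proof.
move=> xP xQ xL aa' qc.
have cN : (-1 : R) != 1.
  by rewrite eq_sym -subr_eq0 opprK paddr_eq0 ?ler01 // oner_eq0.
have c2 : c * c = 1 by case: xP => -[-> _]; rewrite ?mulrNN mulr1.
have stL : (spin_lfun x @: frL D)%VS == frL D.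
  have sub : (spin_lfun x @: frL D <= frL D)%VS.
    apply/subvP => _ /memv_imgP[v /(bL_mem B)[b ->] ->].
    apply/(bL_mem B); exists (c *: b).
    by rewrite lfunE /= mulmxA xL -scalemxAl scalemxAr.
  rewrite eqEsubv sub; apply/subvP => v /(bL_mem B)[b ->].
  have -> : bL *m b = spin_lfun x (bL *m (c *: b)).
    by rewrite lfunE /= mulmxA xL -scalemxAr -scalemxAl scalerA c2 scale1r.
  by apply: memv_img; apply/(bL_mem B); exists (c *: b).
pose y := SpinStab stL.
have dPP' : \dim (frP D) = \dim (frP' D) by rewrite frP_dim frP'_dim.
have yQ : (isom_val (restrF y) @: frQ D)%VS = frQ D.
  exact: restrF_imgP (bQ_onb B) (bQ_onb B) _ (xQ : pi y *m _ = _).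
have yd : det_on (frQ D) (restrF y) = c.
  by rewrite (restrF_det (bQ_onb B) (frQ_dim D) (xQ : pi y *m _ = _)).
have yP : in_hbar (restrF y).
  case: xP => -[c1 [xP xP']].
    have yP := restrF_imgP (bP_onb B) (bP_onb B) erefl (xP : pi y *m _ = _).
    have yP' :=
      restrF_imgP (bP'_onb B) (bP'_onb B) erefl (xP' : pi y *m _ = _).
    split=> //; first by left.
      rewrite (@restrF_det _ _ _ _ _ _ (block_mx a 0 0 a') (bPP'_onb B) dimPP').
        by rewrite det_ublock.
      by rewrite mul_mx_row mul_row_block !mulmx0 addr0 add0r -xP -xP'.
    by rewrite yd /perm_sign yP eqxx.
  have yP := restrF_imgP (bP_onb B) (bP'_onb B) dPP' (xP : pi y *m _ = _).
  have yP' :=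
    restrF_imgP (bP'_onb B) (bP_onb B) (esym dPP') (xP' : pi y *m _ = _).
  split=> //; first by right.
    rewrite (@restrF_det _ _ _ _ _ _ (block_mx 0 a' a 0) (bPP'_onb B) dimPP').
      by rewrite det_swap_blocks sqrrN expr1n mul1r mulrC.
    by rewrite mul_mx_row mul_row_block !mulmx0 addr0 add0r -xP -xP'.
  by rewrite yd c1 /perm_sign yP eq_sym (negbTE (@frPP'_neq R D)).
have yH : `[< in_hbar (restrF y) >] by apply/asboolP.
by exists (HGrp yH) => //; rewrite (hgrp_alphaE (xQ : pi (HGrp yH) *m _ = _)).
Qed.

End HgrpInBasis.

(** * Pairs of type IIIa factor through H *)

Lemma multiplicative_of (G H : groupType) (f : G -> H) :
  {morph f : x y / (x * y)%g} ->
  exists g : {multiplicative G -> H}, forall x, g x = f x.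
Proof.
move=> fM; pose m := isMultiplicative.Build G H f fM.
by exists (HB.pack_for {multiplicative G -> H} f m).
Qed.

Lemma hgrp_incl_inj (R : realType) (D : frame R) : injective (@hgrp_incl R D).
Proof. by move=> h k /val_inj/val_inj. Qed.

Lemma flip_adapted_basis (R : realType) (D : frame R) (B : adapted_basis D)
    (C : 'M[R]_2) : C^T *m C = 1%:M ->
  exists2 B' : adapted_basis D, bP B' = bP B & bP' B' = bP' B *m C.
Proof.
move=> CC; have [PP PF PU] := bP'_onb B.
have C'B : onb_of (frP' D) (bP' B *m C).
  split=> [|a|u].
  - by rewrite trmx_mul mulmxA -(mulmxA C^T) PP mulmx1.
  - by rewrite -mulmxA.
  - rewrite PU; split=> -[a ->]; last by exists (C *m a); rewrite mulmxA.
    by exists (C^T *m a); rewrite -mulmxA (mulmxA C) (mulmx1C CC) mul1mx.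
by exists (AdaptedBasis (bP_onb B) C'B (bQ_onb B) (bL_unit B) (bL_mem B)).
Qed.

Section Descent.
Variables (R : realType) (D : frame R) (eps : sgnchar R (hbar D)).
Hypothesis eps_det : forall f : hbar D, hbar_alpha D f = 1 ->
  eps f = det_on (frP D) f /\ eps f = det_on (frP' D) f.
Variables (Gamma : groupType) (chi : sgnchar R Gamma).
Variables (r : {multiplicative Gamma -> spin R 7}) (eta : sgnchar R Gamma).
Variables (V0 : rep R (sgnker chi) 2) (Q' : rep R Gamma 2).
Variables (s : Gamma) (s_out : chi s = -1).
Hypothesis V0_det : forall x, \det (V0 x) = eta (ker_incl x).
Hypothesis Q'_det : forall x, \det (Q' x) = chi x.
Hypotheses (V0_orth : orth_rep V0) (Q'_orth : orth_rep Q').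

Let W := rep_sum (rep_sum Q' (rep_ind V0 s_out)) (rep_sgn chi).
Hypothesis rW : rep_iso (spin_rep r) W.

Let W_orth : orth_rep W.
Proof.
apply: orth_rep_sum (orth_rep_sgn _).
exact: orth_rep_sum Q'_orth (orth_rep_ind s_out V0_orth).
Qed.

Let det_orth n (A : 'M[R]_n) : A^T *m A = 1%:M -> \det A * \det A = 1.
Proof. by rewrite -{1}det_tr -det_mulmx => ->; rewrite det1. Qed.

(** An orthogonal intertwiner carries the adapted basis to a decomposition
    of the standard module; it can be lifted to the spin group after
    correcting the sign of its determinant on the line, where the action is
    by scalars. *)
Lemma conjugate_into_frame (B : adapted_basis D) :
  exists g : spin R 7, forall x,
    spin_pi (g * r x * g^-1)%g *m frame_mx B = frame_mx B *m W x.
Proof.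
have BB := frame_mx_orth B.
have [] := orth_rep_iso _ W_orth rW; first by move=> x; exact: spin_pi_orth.
move=> O [OO OOt OW].
pose d : R := \det (frame_mx B *m O).
have FO : (frame_mx B *m O)^T *m (frame_mx B *m O) = 1%:M.
  by rewrite trmx_mul mulmxA -(mulmxA O^T) BB mulmx1.
have dd : d * d = 1 by exact: det_orth.
pose E : 'M[R]_(2 + (2 + 2) + 1) := block_mx 1%:M 0 0 d%:M.
have EE : E^T *m E = 1%:M.
  rewrite tr_block_mx !trmx0 trmx1 tr_scalar_mx mulmx_block.
  by rewrite !(mul0mx, mulmx0, addr0, add0r, mulmx1) -scalar_mxM dd
    -scalar_mx_block.
have EW x : E *m W x = W x *m E.
  rewrite /W [in RHS]/= [W _]/= !mulmx_block.
  rewrite !(mul0mx, mulmx0, addr0, add0r, mulmx1, mul1mx).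
  by rewrite -!scalar_mxM mulrC.
have dE : \det (frame_mx B *m E *m O) = 1.
  have -> : frame_mx B *m E *m O =
      (frame_mx B *m E *m (frame_mx B)^T) *m (frame_mx B *m O).
    by rewrite mulmxA -(mulmxA _ _ (frame_mx B)) BB mulmx1.
  by rewrite det_mulmx det_conj_mx // det_ublock det1 mul1r det_scalar1.
have [||g gE] := @spin_lift R 7 (frame_mx B *m E *m O) => //.
  have FE : (frame_mx B *m E)^T *m (frame_mx B *m E) = 1%:M.
    by rewrite trmx_mul mulmxA -(mulmxA E^T) BB mulmx1.
  by rewrite trmx_mul mulmxA -(mulmxA O^T) FE mulmx1.
have gO : frame_mx B = spin_pi g *m (O^T *m E^T).
  rewrite gE mulmxA -(mulmxA _ O) OOt mulmx1 -mulmxA (mulmx1C EE) mulmx1 //.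
exists g => x; rewrite {1}gO mulmxA -spin_piM mulgVK.
rewrite spin_piM gE -!mulmxA (mulmxA O) [O *m _]OW !mulmxA.
rewrite -(mulmxA _ O) OOt mulmx1 -(mulmxA _ E) EW.
by rewrite mulmxA -(mulmxA _ E) (mulmx1C EE) mulmx1.
Qed.

(** The element [s] acts by the identity matrix from the block [1 (x) V0] to
    the block [s (x) V0], so its image sends the chosen basis of [P] to that
    of [P']; this normalization is what allows comparing two choices of
    basis. *)
Lemma descend_in_basis (B : adapted_basis D) :
  exists (g : spin R 7) (f : {multiplicative Gamma -> hgrp D}),
    [/\ forall x, hgrp_incl (f x) = (g * r x * g^-1)%g,
        forall x, chi x = inflate (hbar_alpha D) (f x),
        forall x, chi x = 1 -> eta x = inflate eps (f x)
      & spin_pi (f s) *m bP B = bP' B].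
Proof.
have [g gW] := conjugate_into_frame B.
have gQ x : spin_pi (g * r x * g^-1)%g *m bQ B = bQ B *m Q' x.
  have := gW x; rewrite /frame_mx /W [W x]/= !mul_mx_row.
  rewrite !mul_row_block !(mulmx0, addr0, add0r).
  by case/eq_row_mx => /eq_row_mx[].
have gP x : row_mx (spin_pi (g * r x * g^-1)%g *m bP B)
    (spin_pi (g * r x * g^-1)%g *m bP' B) =
    row_mx (bP B) (bP' B) *m ind_mx V0 s x.
  have := gW x; rewrite /frame_mx /W [W x]/= !mul_mx_row.
  rewrite !mul_row_block !(mulmx0, addr0, add0r).
  by case/eq_row_mx => /eq_row_mx[].
have gL x : spin_pi (g * r x * g^-1)%g *m bL B = chi x *: bL B.
  have := gW x; rewrite /frame_mx /W [W x]/= !mul_mx_row.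
  rewrite !mul_row_block !(mulmx0, addr0, add0r).
  by case/eq_row_mx => _; rewrite mul_mx_scalar.
have gPin x : chi x = 1 ->
    spin_pi (g * r x * g^-1)%g *m bP B = bP B *m ker_ext V0 x /\
    spin_pi (g * r x * g^-1)%g *m bP' B = bP' B *m ker_ext V0 (s^-1 * x * s)%g.
  move=> x1; have := gP x; rewrite (ind_mx_in s_out) // mul_row_block.
  by rewrite !(mulmx0, addr0, add0r) => /eq_row_mx.
have gPout x : chi x = -1 ->
    spin_pi (g * r x * g^-1)%g *m bP B = bP' B *m ker_ext V0 (s^-1 * x)%g /\
    spin_pi (g * r x * g^-1)%g *m bP' B = bP B *m ker_ext V0 (x * s)%g.
  move=> xN; have := gP x; rewrite (ind_mx_out s_out) // mul_row_block.
  by rewrite !(mulmx0, addr0, add0r) => /eq_row_mx.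
have kdet y : chi y = 1 -> \det (ker_ext V0 y) = eta y.
  by move=> /eqP y1; have := V0_det (SgnKer y1); rewrite -ker_extE.
have eta2 y : eta y * eta y = 1.
  by case: (sgn_pm1 eta y) => ->; rewrite ?mulrNN mulr1.
have lift x : exists h, hgrp_incl h = (g * r x * g^-1)%g /\
    inflate (hbar_alpha D) h = chi x.
  have [x1|xN] := sgn_pm1 chi x.
    have sxs : chi (s^-1 * x * s)%g = 1.
      by rewrite !sgnM sgnV s_out x1 mulr1 mulrNN mulr1.
    have [|||||h hx hc] := @hgrp_intro _ _ B (g * r x * g^-1)%g
       (ker_ext V0 x) (ker_ext V0 (s^-1 * x * s)%g) (Q' x) (chi x) => //.
    - by left; rewrite x1; split=> //; exact: gPin.
    - rewrite !kdet // !sgnM sgnV.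
      transitivity (eta x * eta x * (eta s * eta s)); first by ring.
      by rewrite !eta2 mulr1.
    by exists h.
  have sx : chi (s^-1 * x)%g = 1 by rewrite sgnM sgnV s_out xN mulrNN mulr1.
  have xs : chi (x * s)%g = 1 by rewrite sgnM s_out xN mulrNN mulr1.
  have [|||||h hx hc] := @hgrp_intro _ _ B (g * r x * g^-1)%g
     (ker_ext V0 (s^-1 * x)%g) (ker_ext V0 (x * s)%g) (Q' x) (chi x) => //.
  - by right; rewrite xN; split=> //; exact: gPout.
  - rewrite !kdet // !sgnM sgnV.
    transitivity (eta x * eta x * (eta s * eta s)); first by ring.
    by rewrite !eta2 mulr1.
  by exists h.
pose f0 x := sval (cid (lift x)).
have f0E x : hgrp_incl (f0 x) = (g * r x * g^-1)%g.
  by case: (svalP (cid (lift x))).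
have f0a x : inflate (hbar_alpha D) (f0 x) = chi x.
  by case: (svalP (cid (lift x))).
have [|f ff] := @multiplicative_of _ _ f0.
  move=> x y; apply: hgrp_incl_inj; rewrite hgrp_inclM !f0E gmulfM.
  by rewrite !mulgA mulgVK.
have piE x : spin_pi (f x) = spin_pi (g * r x * g^-1)%g by rewrite -f0E -ff.
exists g, f; split=> [x|x|x x1|].
- by rewrite ff.
- by rewrite ff f0a.
- have fx1 : inflate (hbar_alpha D) (f x) = 1 by rewrite ff f0a.
  have [a [a' [aE _ <- _]]] := hgrp_actP B eps_det fx1.
  rewrite -(kdet _ x1); congr (\det _).
  have [gPx _] := gPin x x1.
  by rewrite -(mulmx_onbK (ker_ext V0 x) (bP_orth B)) -gPx -piE aE
    (mulmx_onbK _ (bP_orth B)).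
- have [gPs _] := gPout s s_out.
  have k1 : ker_ext V0 1%g = 1%:M.
    by have := ker_extE V0 1%g; rewrite rep1.
  by rewrite piE gPs mulVg k1 mulmx1.
Qed.
End Descent.

Section DescentConclusion.
Variables (R : realType) (D : frame R) (eps : sgnchar R (hbar D)).
Hypothesis eps_det : forall f : hbar D, hbar_alpha D f = 1 ->
  eps f = det_on (frP D) f /\ eps f = det_on (frP' D) f.
Variables (Gamma : groupType) (chi : sgnchar R Gamma).
Variables (r : {multiplicative Gamma -> spin R 7}) (eta : sgnchar R Gamma).

(** The descent fixes [eps \o f] on the kernel of [chi] only. Composing the
    basis of [P'] with a reflection multiplies the image of [s] by an
    element of [H] acting on [P] as a reflection, which changes the sign of
    [eps] there: one of the two choices gives [eta]. *)
Lemma IIIa_factors : type_IIIa r eta chi ->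
  exists (g : spin R 7) (f : {multiplicative Gamma -> hgrp D}),
    [/\ forall x, hgrp_incl (f x) = (g * r x * g^-1)%g,
        forall x, chi x = inflate (hbar_alpha D) (f x)
      & forall x, eta x = inflate eps (f x)].
Proof.
case=> _ _ _ [U [rU [V0 [Q' [s [s_out [UV0 V0d Q'd UQV]]]]]]].
have r_orth : orth_rep (spin_rep r) by move=> x; exact: spin_pi_orth.
have rQV : rep_iso (spin_rep r)
    (rep_sum (rep_sum Q' (rep_ind V0 s_out)) (rep_sgn chi)).
  exact: rep_iso_trans rU (rep_sum_iso UQV (rep_iso_refl _)).
have [C0 [C0u V1_orth]] :
    exists C (Cu : C \in unitmx), orth_rep (rep_conj V0 Cu).
  apply: (@contains_orth_rep _ _ _ _ (rep_res chi (spin_rep r))).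
    by move=> x; exact: r_orth.
  apply: rep_contains_iso (rep_res_iso chi rU) _.
  exact: (rep_contains_suml (rep_res chi (rep_sgn chi)) UV0).
have [C1 [C1u Q1_orth]] :
    exists C (Cu : C \in unitmx), orth_rep (rep_conj Q' Cu).
  apply: (contains_orth_rep r_orth); apply: rep_contains_iso rQV _.
  do 2!apply: rep_contains_suml; exists 1%:M; rewrite mxrank1.
  by split=> // x; rewrite mul1mx mulmx1.
set V1 := rep_conj V0 C0u in V1_orth; set Q1 := rep_conj Q' C1u in Q1_orth.
have conj_det n (C X : 'M[R]_n) : C \in unitmx ->
    \det (C *m X *m invmx C) = \det X.
  by move=> Cu; rewrite det_conj_mx // mulVmx.
have V1d x : \det (V1 x) = eta (ker_incl x) by rewrite conj_det.
have Q1d x : \det (Q1 x) = chi x by rewrite conj_det.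
have rW : rep_iso (spin_rep r)
    (rep_sum (rep_sum Q1 (rep_ind V1 s_out)) (rep_sgn chi)).
  apply: rep_iso_trans rQV (rep_sum_iso _ (rep_iso_refl _)).
  exact: rep_sum_iso (rep_conj_iso _ _) (rep_ind_conj_iso _ _ _).
have glue (f : {multiplicative Gamma -> hgrp D}) :
    (forall x, chi x = 1 -> eta x = inflate eps (f x)) ->
    eta s = inflate eps (f s) -> forall x, eta x = inflate eps (f x).
  move=> f1 fs x; have [x1|xN] := sgn_pm1 chi x; first exact: f1.
  have sx : chi (s^-1 * x)%g = 1 by rewrite sgnM sgnV s_out xN mulrNN mulr1.
  by rewrite -[x](mulVKg s) (sgnM eta) fs (f1 _ sx) gmulfM (sgnM (inflate eps)).
have [B] := adapted_basis_exists D.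
have [g [f [fr fa f1 fs]]] :=
  descend_in_basis eps_det V1d Q1d V1_orth Q1_orth rW B.
have [e1|e1] := eqVneq (eta s) (inflate eps (f s)).
  by exists g, f; split=> //; exact: glue.
pose C : 'M[R]_2 := refl_mx (delta_mx 0 0).
have e0 : dotv (delta_mx 0 0 : 'cV[R]_2) (delta_mx 0 0) = 1.
  by rewrite /dotv trmx_delta -rowE !mxE !eqxx.
have CC : C^T *m C = 1%:M by rewrite refl_mx_tr refl_mxK.
have [B' B'P B'P'] := flip_adapted_basis B CC.
have [g' [f' [fr' fa' f1' fs']]] :=
  descend_in_basis eps_det V1d Q1d V1_orth Q1_orth rW B'.
exists g', f'; split=> //; apply: glue => //.
rewrite B'P B'P' in fs'.
pose h := ((f s)^-1 * f' s)%g.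
have ha : inflate (hbar_alpha D) h = 1.
  by rewrite sgnM sgnV -fa -fa' s_out mulrNN mulr1.
have hP : spin_pi h *m bP B = bP B *m C.
  rewrite spin_piM -mulmxA fs' -fs !mulmxA -spin_piM.
  rewrite (_ : (_ * _)%g = 1%g) ?spin_pi1 ?mul1mx //.
  by rewrite -[LHS]/(hgrp_incl ((f s)^-1 * f s)%g) mulVg.
have [a [a' [aE _ ae _]]] := hgrp_actP B eps_det ha.
have hN : inflate eps h = -1.
  rewrite -ae -[a](mulmx_onbK _ (bP_orth B)) -aE hP (mulmx_onbK _ (bP_orth B)).
  exact: det_refl_mx.
have : inflate eps (f' s) = - inflate eps (f s).
  by rewrite -[f' s](mulVKg (f s)) sgnM -/h hN mulrN1.
move=> ->; move: e1; case: (sgn_pm1 eta s) => ->;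
  case: (sgn_pm1 (inflate eps) (f s)) => ->; rewrite ?opprK ?eqxx //.
Qed.

End DescentConclusion.

(** * The pair formed by the inclusion of H and eps *)

Section PlaneIsometries.
Variable R : realType.

Lemma refl_mulmx_onb m k (X : 'M[R]_(m, k)) u : X^T *m X = 1%:M ->
  refl_mx (X *m u) *m X = X *m refl_mx u.
Proof.
move=> XX; rewrite /refl_mx mulmxBl mulmxBr mul1mx mulmx1 trmx_mul.
by rewrite -!mulmxA XX mulmx1 !mulmxA scalemxAr.
Qed.

Lemma refl_mulmx_orth m k (v : 'cV[R]_m) (Y : 'M[R]_(m, k)) : v^T *m Y = 0 ->
  refl_mx v *m Y = Y.
Proof.
by move=> vY; rewrite /refl_mx mulmxBl mul1mx -mulmxA vY mulmx0 subr0.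
Qed.

Lemma det_eq0_ker n (A : 'M[R]_n) : \det A = 0 ->
  exists2 u : 'cV_n, u != 0 & A *m u = 0.
Proof.
rewrite -det_tr => /eqP/det0P[v v0 vA]; exists v^T.
  by apply: contraNneq v0 => /(congr1 trmx); rewrite trmxK trmx0 => ->.
by apply: trmx_inj; rewrite trmx_mul trmxK vA trmx0.
Qed.

(** [1 - a = (a^T - 1) a] and [1 + a = (a^T + 1) a] give determinants equal
    to their opposites, the dimension being even in the first case. *)
Lemma plane_refl_eigen (a : 'M[R]_2) : a^T *m a = 1%:M -> \det a = -1 ->
  (exists2 u : 'cV_2, u != 0 & a *m u = u) /\
  (exists2 u : 'cV_2, u != 0 & a *m u = - u).
Proof.
move=> aa da.
have opp0 (d : R) : d = - d -> d = 0.
  by move=> /eqP; rewrite -addr_eq0 -mulr2n mulrn_eq0 /= => /eqP.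
split.
  have [|u u0 au] := @det_eq0_ker _ (1%:M - a).
    apply: opp0; rewrite -{1}aa -{3}[a]mul1mx -mulmxBl det_mulmx da mulrN1.
    by rewrite -det_tr linearB /= trmxK trmx1 -opprB -scaleN1r detZ sqrrN expr1n
      mul1r.
  by exists u => //; apply/esym/subr0_eq; rewrite -au mulmxBl mul1mx.
have [|u u0 au] := @det_eq0_ker _ (1%:M + a).
  apply: opp0; rewrite -{1}aa -{3}[a]mul1mx -mulmxDl det_mulmx da mulrN1.
  by rewrite -det_tr linearD /= trmxK trmx1 addrC.
by exists u => //; apply/eqP; rewrite -addr_eq0 addrC -{1}[u]mul1mx -mulmxDl au.
Qed.

Lemma mulmx_onb_neq0 m k (X : 'M[R]_(m, k)) (u : 'cV_k) : X^T *m X = 1%:M ->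
  u != 0 -> X *m u != 0.
Proof.
move=> XX; apply: contraNneq => Xu.
by rewrite -[u](mulmx_onbK _ XX) Xu mulmx0.
Qed.

Lemma dotv_delta n i (v : 'cV[R]_n) : dotv (delta_mx i 0) v = v i 0.
Proof. by rewrite /dotv trmx_delta -rowE mxE. Qed.

Lemma dotv_delta1 n i : dotv (delta_mx i 0 : 'cV[R]_n) (delta_mx i 0) = 1.
Proof. by rewrite dotv_delta mxE !eqxx. Qed.

Lemma dotv_onb m k (X : 'M[R]_(m, k)) u v : X^T *m X = 1%:M ->
  dotv (X *m u) (X *m v) = dotv u v.
Proof. by move=> XX; rewrite /dotv trmx_mul -mulmxA (mulmx_onbK _ XX). Qed.

Lemma refl_fixed_eq0 n (y : 'cV[R]_n) :
  (forall i, refl_mx (delta_mx i 0) *m y = y) -> y = 0.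
Proof.
move=> yf; apply/colP => i; have := yf i; rewrite refl_mxE dotv_delta.
move=> /colP/(_ i)/eqP; rewrite !mxE !eqxx mulr1 subr_eq addrC eq_sym.
by rewrite -subr_eq0 addrK mulf_eq0 pnatr_eq0 => /eqP.
Qed.

Lemma spin_pi_opp n (x y : spin R n) (c : R) : c * c = 1 ->
  val y = c *: val x -> spin_pi y = spin_pi x.
Proof.
move=> cc yx.
have yVx : val y^-1%g = c *: val x^-1%g.
  have yVx : val y * (c *: val x^-1%g) = 1.
    by rewrite yx -scalerAl -scalerAr scalerA cc scale1r spin_valK.
  by rewrite -[LHS]mulr1 -yVx mulrA spin_valVK mul1r.
apply/matrixP => i j; rewrite !mxE yVx yx -!(scalerAl, scalerAr) scalerA cc.
by rewrite scale1r.
Qed.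

Lemma det_mx22 (K : comNzRingType) (A : 'M[K]_2) :
  \det A = A 0 0 * A 1 1 - A 0 1 * A 1 0.
Proof.
rewrite (expand_det_row _ 0) !big_ord_recl big_ord0 addr0 /cofactor !det_mx11.
rewrite !mxE /= addn0 addn1 expr0 expr1 mul1r mulN1r mulrN.
by congr (A _ _ * A _ _ - A _ _ * A _ _); apply: val_inj.
Qed.

End PlaneIsometries.

Section UniversalPair.
Variables (R : realType) (D : frame R) (eps : sgnchar R (hbar D)).
Hypothesis eps_det : forall f : hbar D, hbar_alpha D f = 1 ->
  eps f = det_on (frP D) f /\ eps f = det_on (frP' D) f.
Variable B : adapted_basis D.
Local Notation alpha := (inflate (hbar_alpha D)).
Local Notation epsH := (inflate eps).
Local Notation bP := (bP B).
Local Notation bP' := (bP' B).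
Local Notation bQ := (bQ B).
Local Notation bL := (bL B).
Local Notation pi := (@spin_pi R 7).
Local Notation rho := (@hgrp_incl R D).
Implicit Types h : hgrp D.

Let colorth k l (X : 'M[R]_(7, k)) (Y : 'M[R]_(7, l)) (u : 'cV_k) :
  X^T *m Y = 0 -> (X *m u)^T *m Y = 0.
Proof. by move=> XY; rewrite trmx_mul -mulmxA XY mulmx0. Qed.

(** The product of a reflection along a vector of [P] and one along a vector
    of [P'], lifted as the product of these vectors in the Clifford algebra. *)
Lemma hgrp_refl_pair (u u' : 'cV[R]_2) : dotv u u = 1 -> dotv u' u' = 1 ->
  exists h, [/\ val (rho h) = clv (bP *m u) * clv (bP' *m u'),
    [/\ pi h *m bP = bP *m refl_mx u, pi h *m bP' = bP' *m refl_mx u',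
        pi h *m bQ = bQ & pi h *m bL = bL], alpha h = 1 & epsH h = -1].
Proof.
move=> u1 u'1.
have [x xE piE] : exists2 x : spin R 7, val x = clv (bP *m u) * clv (bP' *m u')
    & pi x = refl_mx (bP *m u) *m refl_mx (bP' *m u').
  by apply: spin_pair; rewrite dotv_onb ?bP_orth ?bP'_orth.
have xP : pi x *m bP = bP *m refl_mx u.
  rewrite piE -mulmxA (refl_mulmx_orth (colorth _ (trmx_mul_eq0 (bPP' B)))).
  exact/refl_mulmx_onb/bP_orth.
have xP' : pi x *m bP' = bP' *m refl_mx u'.
  rewrite piE -mulmxA refl_mulmx_onb ?bP'_orth // mulmxA.
  by rewrite (refl_mulmx_orth (colorth _ (bPP' B))).
have xQ : pi x *m bQ = bQ.
  rewrite piE -mulmxA (refl_mulmx_orth (colorth _ (bP'Q B))).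
  exact/refl_mulmx_orth/colorth/bPQ.
have xL : pi x *m bL = bL.
  rewrite piE -mulmxA (refl_mulmx_orth (colorth _ (trmx_mul_eq0 (bLP' B)))).
  exact/refl_mulmx_orth/colorth/trmx_mul_eq0/bLP.
have [|||||h hx h1] := @hgrp_intro _ _ B x (refl_mx u) (refl_mx u') 1%:M 1.
- by left.
- by rewrite mulmx1.
- by rewrite scale1r.
- by rewrite !det_refl_mx // mulrNN mulr1.
- exact: det1.
have [a [_ [aE _ da _]]] := hgrp_actP B eps_det h1.
rewrite -{}hx in xE xP xP' xQ xL; exists h; split=> //.
rewrite -da; have : bP *m a = bP *m refl_mx u by rewrite -aE.
move/(congr1 (mulmx bP^T)); rewrite !(mulmx_onbK _ (bP_orth B)) => ->.
exact: det_refl_mx.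
Qed.

(** Exchanging the bases of [P] and [P'], reflecting [Q] along [u] and
    negating [L] is an isometry of determinant 1. *)
Lemma hgrp_swap (u : 'cV[R]_2) : dotv u u = 1 -> exists h,
  [/\ pi h *m bP = bP', pi h *m bP' = bP, pi h *m bQ = bQ *m refl_mx u
    & alpha h = -1].
Proof.
move=> u1; have uu : (refl_mx u)^T *m refl_mx u = 1%:M.
  by rewrite refl_mx_tr refl_mxK.
have [||x xE] := @spin_frame_lift _ _ B
    (block_mx (block_mx (refl_mx u) 0 0 (block_mx 0 1%:M 1%:M 0)) 0 0 (- 1%:M)).
- rewrite !tr_block_mx !trmx0 !trmx1 !mulmx_block uu.
  rewrite !(mul0mx, mulmx0, addr0, add0r, mulmx1, mulNmx, mulmxN, opprK).
  by rewrite ?oppr0 linearN /= trmx1 ?oppr0 opprK -!scalar_mx_block.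
- rewrite !det_ublock det_refl_mx // det_swap_blocks det1 sqrrN expr1n !mulr1.
  by rewrite -scaleN1r detZ det1 expr1 mulr1 mulrNN mulr1.
move: xE; rewrite /frame_mx !mul_mx_row !mul_row_block.
rewrite !(mulmx0, addr0, add0r, mulmx1, mulmxN).
case/eq_row_mx => /eq_row_mx[xQ /eq_row_mx[xP xP']] xL.
have [|||||h hx hN] := @hgrp_intro _ _ B x 1%:M 1%:M (refl_mx u) (-1) => //.
- by right; rewrite !mulmx1.
- by rewrite scaleN1r.
- by rewrite det1 mulr1.
- exact: det_refl_mx.
by exists h; rewrite -hx in xP xP' xQ.
Qed.

(** Outside [H_0] the line is negated and the action on [Q] is a reflection;
    inside [H_0], [eps h = -1] means that the action on [P] is a reflection. *)
Lemma eps_conj_each h : exists g : spin R 7,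
  val (g * rho h * g^-1)%g = epsH h *: val (rho h).
Proof.
have [e1|eN] := sgn_pm1 epsH h.
  by exists 1%g; rewrite e1 scale1r mul1g invg1 mulg1.
rewrite eN scaleN1r; have [h1|hN] := sgn_pm1 alpha h.
  have [a [_ [aE _ da _]]] := hgrp_actP B eps_det h1; rewrite eN in da.
  have aa := pi_coef_orth (bP_orth B) (bP_orth B) aE.
  have [[w w0 aw] [v v0 av]] := plane_refl_eigen aa da.
  apply: (@spin_conj_opp _ _ _ (bP *m v) (bP *m w)).
  - exact: mulmx_onb_neq0 (bP_orth B) v0.
  - exact: mulmx_onb_neq0 (bP_orth B) w0.
  - by rewrite mulmxA aE -mulmxA av mulmxN.
  - by rewrite mulmxA aE -mulmxA aw.
have [q qE dq] := hgrp_actQ B h; rewrite hN in dq.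
have qq := pi_coef_orth (bQ_orth B) (bQ_orth B) qE.
have [[w w0 qw] _] := plane_refl_eigen qq dq.
apply: (@spin_conj_opp _ _ _ bL (bQ *m w)).
- rewrite -[bL]mulmx1; apply: mulmx_onb_neq0 (bL_unit B) _.
  by apply/eqP => /matrixP/(_ 0 0)/eqP; rewrite !mxE eqxx oner_eq0.
- exact: mulmx_onb_neq0 (bQ_orth B) w0.
- by rewrite (hgrp_actL B) hN scaleN1r.
- by rewrite mulmxA qE -mulmxA qw.
Qed.

Lemma clv_orth_anticomm n (v w : 'cV[R]_n) : dotv v w = 0 ->
  clv w * clv v = - (clv v * clv w).
Proof.
move=> vw; apply/eqP; rewrite -addr_eq0 addrC clvM vw mulr0 scale0r //.
Qed.

(** The product of an orthonormal basis of [P] is the volume element of [P],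
    which conjugation by [h] multiplies by the determinant of [h] on [P]. *)
Lemma eps_conj_ker : exists g : spin R 7, forall h, alpha h = 1 ->
  val (g * rho h * g^-1)%g = epsH h *: val (rho h).
Proof.
pose e i : 'cV[R]_2 := delta_mx i 0; pose p i := bP *m e i.
have p1 i : dotv (p i) (p i) = 1 by rewrite dotv_onb ?bP_orth // dotv_delta1.
have p01 : dotv (p 0) (p 1) = 0.
  by rewrite dotv_onb ?bP_orth // dotv_delta mxE.
have [g gE _] := spin_pair (p1 0) (p1 1); exists g => h h1.
have [a [_ [aE _ da _]]] := hgrp_actP B eps_det h1.
have aa := pi_coef_orth (bP_orth B) (bP_orth B) aE.
apply/spin_val_conj; rewrite -da gE.
have hp j : pi (rho h) *m p j = a 0 j *: p 0 + a 1 j *: p 1.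
  rewrite /p mulmxA aE -mulmxA !scalemxAr -mulmxDr; congr (_ *m _).
  apply/colP => i; rewrite -colE !mxE eqxx andbT.
  by case: i => [[|[|//]] i2] /=; rewrite ?mulr1 ?mulr0 ?addr0 ?add0r;
    congr (a _ _); apply: val_inj.
have vol : val (rho h) * (clv (p 0) * clv (p 1)) =
    \det a *: (clv (p 0) * clv (p 1) * val (rho h)).
  rewrite mulrA (clv_spin (hp 0)) -mulrA (clv_spin (hp 1)) mulrA scalerAl.
  congr (_ * _); rewrite !linearD !linearZ /= mulrDl !mulrDr.
  rewrite -!(scalerAl, scalerAr) !scalerA !clv_sqr !p1 (clv_orth_anticomm p01).
  have a01 : a 0 0 * a 0 1 + a 1 0 * a 1 1 = 0.
    move/matrixP: aa => /(_ 0 1).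
    rewrite !mxE !big_ord_recl big_ord0 addr0 !mxE.
    by rewrite (_ : lift ord0 ord0 = 1) //; apply: val_inj.
  rewrite (addrC (_ *: - _)) addrACA -scalerDl a01 scale0r add0r scalerN.
  by rewrite -scalerBl det_mx22; congr (_ *: _); ring.
have dd : \det a * \det a = 1.
  by rewrite da; case: (sgn_pm1 epsH h) => ->; rewrite ?mulrNN mulr1.
by rewrite vol scalerA dd scale1r.
Qed.

(** If conjugation by [g] multiplied [H] by [eps], then [pi g] would commute
    with [H], hence act on [P] and [P'] by the same sign [c]: a basis vector
    [p] of [P] spans the part of the standard module negated by all the
    pairs of reflections along [p] and vectors of [P'], and [H] exchanges
    [P] and [P']. Then [g] would commute with the product of two unit
    vectors of [P] and [P'], an element of [H] where [eps] is [-1]. *)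
Lemma eps_not_in_X : ~ exists g : spin R 7, forall h,
  val (g * rho h * g^-1)%g = epsH h *: val (rho h).
Proof.
case=> g gE.
have gC h : pi g *m pi h = pi h *m pi g.
  have cc : epsH h * epsH h = 1.
    by case: (sgn_pm1 epsH h) => ->; rewrite ?mulrNN mulr1.
  have := spin_pi_opp cc (gE h) => ghg.
  rewrite -[pi h in RHS]ghg -!spin_piM; congr spin_pi.
  by rewrite mulgVK.
pose e i : 'cV[R]_2 := delta_mx i 0.
have e1 i : dotv (e i) (e i) = 1 by exact: dotv_delta1.
pose p := bP *m e 0; pose p' := bP' *m e 0; pose v := pi g *m p.
have re i : refl_mx (e i) *m e i = - e i.
  by rewrite refl_mxE e1 mulr1 mulr2n scalerDl scale1r opprD addNKr.
have hv i h : pi h *m bP = bP *m refl_mx (e 0) ->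
    pi h *m bP' = bP' *m refl_mx (e i) -> pi h *m bQ = bQ -> pi h *m bL = bL ->
    [/\ refl_mx (e 0) *m (bP^T *m v) = - (bP^T *m v),
       refl_mx (e i) *m (bP'^T *m v) = - (bP'^T *m v),
       bQ^T *m v = - (bQ^T *m v) & bL^T *m v = - (bL^T *m v)].
  move=> hP hP' hQ hL.
  have vN : pi h *m v = - v.
    by rewrite mulmxA -gC -mulmxA (mulmxA (pi h)) hP -!mulmxA re !mulmxN.
  have key k (X Y : 'M[R]_(7, k)) : pi h *m X = Y -> Y^T *m v = - (X^T *m v).
    move=> <-; rewrite trmx_mul -mulmxA -[in LHS](opprK v) -vN mulmxN.
    by rewrite (mulmxA _^T) spin_pi_orth mul1mx mulmxN.
  have := key _ _ _ hP; have := key _ _ _ hP'.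
  by rewrite !trmx_mul !refl_mx_tr -!mulmxA; split=> //; exact: key.
have opp0 m (y : 'cV[R]_m) : y = - y -> y = 0.
  move=> /eqP; rewrite -addr_eq0 -mulr2n -scaler_nat scaler_eq0 pnatr_eq0 /=.
  by move/eqP.
have neg i (y : 'cV[R]_2) : refl_mx (e i) *m y = - y -> y = y i 0 *: e i.
  rewrite refl_mxE dotv_delta => /eqP; rewrite -addr_eq0 addrAC subr_eq0.
  rewrite -mulr2n -scaler_nat -scalerA => /eqP; apply: scalerI.
  by rewrite pnatr_eq0.
have [h0 [h0E [h0P h0P' h0Q h0L] _ h0e]] := hgrp_refl_pair (e1 0) (e1 0).
have [h1 [_ [h1P h1P' h1Q h1L] _ _]] := hgrp_refl_pair (e1 0) (e1 1).
have [v0P v0P' /opp0 vQ /opp0 vL] := hv _ _ h0P h0P' h0Q h0L.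
have [_ v1P' _ _] := hv _ _ h1P h1P' h1Q h1L.
have vP' : bP'^T *m v = 0.
  rewrite (neg _ _ v1P') (neg _ _ v0P') !mxE.
  by rewrite (_ : (1 == 0 :> 'I_2) = false) // mulr0 scale0r.
have [c vc] : exists c, v = c *: p.
  exists ((bP^T *m v) 0 0); rewrite -[LHS]mul1mx.
  rewrite -(mulmx1C_eq erefl (frame_mx_orth B)) -mulmxA /frame_mx !tr_row_mx.
  rewrite !mul_col_mx !mul_row_col vQ vP' vL !mulmx0 add0r !addr0.
  by rewrite {1}(neg _ _ v0P) -scalemxAr.
have cc : c * c = 1.
  have := spin_pi_dot g p p; rewrite -/v vc dotv_scale dotvC dotv_scale mulrA.
  by rewrite dotv_onb ?bP_orth // e1 mulr1.
have [s [sP _ _ _]] := hgrp_swap (e1 0).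
have gp' : pi g *m p' = c *: p'.
  by rewrite /p' -sP -mulmxA mulmxA gC -mulmxA -/p -/v vc -scalemxAr mulmxA.
have gh0 : val g * val (rho h0) = val (rho h0) * val g.
  rewrite h0E -/p -/p' mulrA (clv_spin (erefl v)) vc -mulrA (clv_spin gp').
  by rewrite !linearZ /= -scalerAl -scalerAl -scalerAr scalerA cc scale1r mulrA.
have /spin_val_conj := gE h0; rewrite h0e gh0 -spin_valM scaleN1r => hN.
have := congr1 (fun z => z * val (rho h0 * g)^-1%g) hN.
rewrite mulNr spin_valK => /eqP; rewrite -addr_eq0 -mulr2n -scaler_nat.
by rewrite scaler_eq0 pnatr_eq0 oner_eq0.
Qed.

(** The coordinates of an invariant vector in [P], [P'] and [Q] are fixed by
    all the reflections along basis vectors, and its coordinate on [L] is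
    negated by the exchange of [P] and [P']. *)
Lemma rho_no_invariant (v : 'cV[R]_7) :
  (forall h, pi (rho h) *m v = v) -> v = 0.
Proof.
move=> vf; pose e i : 'cV[R]_2 := delta_mx i 0.
have e1 i : dotv (e i) (e i) = 1 by exact: dotv_delta1.
have key h k (X Y : 'M[R]_(7, k)) : pi h *m X = Y -> Y^T *m v = X^T *m v.
  move=> <-; rewrite trmx_mul -{1}(vf h) -mulmxA (mulmxA (pi h)^T).
  by rewrite spin_pi_orth mul1mx.
have vP : bP^T *m v = 0.
  apply: refl_fixed_eq0 => i.
  have [h [_ [hP _ _ _] _ _]] := hgrp_refl_pair (e1 i) (e1 0).
  by have := key _ _ _ _ hP; rewrite trmx_mul refl_mx_tr -mulmxA.
have vP' : bP'^T *m v = 0.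
  apply: refl_fixed_eq0 => i.
  have [h [_ [_ hP' _ _] _ _]] := hgrp_refl_pair (e1 0) (e1 i).
  by have := key _ _ _ _ hP'; rewrite trmx_mul refl_mx_tr -mulmxA.
have vQ : bQ^T *m v = 0.
  apply: refl_fixed_eq0 => i; have [h [_ _ hQ _]] := hgrp_swap (e1 i).
  by have := key _ _ _ _ hQ; rewrite trmx_mul refl_mx_tr -mulmxA.
have vL : bL^T *m v = 0.
  have [h [_ _ _ hN]] := hgrp_swap (e1 0).
  have := key _ _ _ _ (hgrp_actL B h); rewrite hN scaleN1r linearN mulNmx /=.
  move=> /esym/eqP; rewrite -addr_eq0 -mulr2n -scaler_nat scaler_eq0 pnatr_eq0.
  by move/eqP.
rewrite -[LHS]mul1mx -(mulmx1C_eq erefl (frame_mx_orth B)) -mulmxA /frame_mx.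
by rewrite !tr_row_mx !mul_col_mx vP vP' vQ vL !col_mx0 mulmx0.
Qed.

End UniversalPair.

(** * The standard module of H *)

Section UniversalModule.
Variables (R : realType) (D : frame R) (eps : sgnchar R (hbar D)).
Hypothesis eps_det : forall f : hbar D, hbar_alpha D f = 1 ->
  eps f = det_on (frP D) f /\ eps f = det_on (frP' D) f.
Variable B : adapted_basis D.
Local Notation alpha := (inflate (hbar_alpha D)).
Local Notation epsH := (inflate eps).
Local Notation bP := (bP B).
Local Notation bP' := (bP' B).
Local Notation bQ := (bQ B).
Local Notation bL := (bL B).
Local Notation pi := (@spin_pi R 7).
Local Notation rho := (@hgrp_incl R D).
Implicit Types h : hgrp D.

Fact frame_rep1 k (X : 'M[R]_(7, k)) : X^T *m X = 1%:M ->
  X^T *m pi (rho 1%g) *m X = 1%:M.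
Proof. by move=> XX; rewrite (spin_rep1 rho) mulmx1. Qed.

Lemma rho_Q h : pi (rho h) *m bQ = bQ *m (bQ^T *m pi (rho h) *m bQ).
Proof.
have [q hQ _] := hgrp_actQ B h.
by rewrite -[in RHS]mulmxA [pi _ *m _ in RHS]hQ (mulmx_onbK _ (bQ_orth B)).
Qed.

Lemma rho_P h : alpha h = 1 ->
  pi (rho h) *m bP = bP *m (bP^T *m pi (rho h) *m bP).
Proof.
move=> h1; have [a [_ [hP _ _ _]]] := hgrp_actP B eps_det h1.
by rewrite -[in RHS]mulmxA [pi _ *m _ in RHS]hP (mulmx_onbK _ (bP_orth B)).
Qed.

Fact Q_repM (x y : hgrp D) : bQ^T *m pi (rho (x * y)%g) *m bQ =
  (bQ^T *m pi (rho x) *m bQ) *m (bQ^T *m pi (rho y) *m bQ).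
Proof. by rewrite (spin_repM rho) -!mulmxA [in LHS](rho_Q y) !mulmxA. Qed.

Definition Q_rep : rep R (hgrp D) 2 := Rep (frame_rep1 (bQ_orth B)) Q_repM.

Fact P_rep1 : bP^T *m pi (rho (ker_incl (1%g : sgnker alpha))) *m bP = 1%:M.
Proof. exact: frame_rep1 (bP_orth B). Qed.

Fact P_repM (x y : sgnker alpha) :
  bP^T *m pi (rho (ker_incl (x * y)%g)) *m bP =
  (bP^T *m pi (rho (ker_incl x)) *m bP) *m
  (bP^T *m pi (rho (ker_incl y)) *m bP).
Proof.
rewrite gmulfM (spin_repM rho) -!mulmxA.
rewrite [in LHS](rho_P (h := ker_incl y)) ?mulmxA //.
by case: y => y /= /eqP.
Qed.

Definition P_rep : rep R (sgnker alpha) 2 := Rep P_rep1 P_repM.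

Lemma Q_rep_det h : \det (Q_rep h) = alpha h.
Proof. by rewrite (hgrp_alphaE (rho_Q h)). Qed.

Lemma P_rep_det (x : sgnker alpha) : \det (P_rep x) = epsH (ker_incl x).
Proof.
have x1 : alpha (ker_incl x) = 1 by case: x => x /= /eqP.
have [a [_ [hP _ <- _]]] := hgrp_actP B eps_det x1.
by rewrite /= -mulmxA [pi _ *m _]hP (mulmx_onbK _ (bP_orth B)).
Qed.

Section Swap.
Variables (s : hgrp D) (s_out : alpha s = -1).
Hypothesis sP : pi (rho s) *m bP = bP'.

Lemma rho_PE h : alpha h = 1 -> pi (rho h) *m bP = bP *m ker_ext P_rep h.
Proof.
move=> h1; move/eqP: (h1) => h1'.
by rewrite -[h]/(val (SgnKer h1')) ker_extE rho_P.
Qed.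

(** The columns of [bP'] are the translates by [s] of those of [bP], which
    are a basis of a module over the kernel of [alpha]: together they span a
    module induced from that kernel. *)
Lemma rho_PP'E h :
  pi (rho h) *m row_mx bP bP' = row_mx bP bP' *m ind_mx P_rep s h.
Proof.
have piM (x y : hgrp D) : pi (rho (x * y)%g) = pi (rho x) *m pi (rho y).
  exact: (spin_repM rho).
have sVh : h = (s * (s^-1 * h))%g by rewrite mulVKg.
have [h1|hN] := sgn_pm1 alpha h.
  have shs : alpha (s^-1 * h * s)%g = 1.
    by rewrite !sgnM sgnV s_out h1 mulr1 mulrNN mulr1.
  rewrite (ind_mx_in s_out) // mul_row_block !mulmx0 addr0 add0r mul_mx_row.
  congr row_mx; first exact: rho_PE.
  rewrite -sP -[in RHS]mulmxA -(rho_PE shs) !mulmxA -!piM.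
  congr (pi (rho _) *m _).
  by rewrite !mulgA mulgV mul1g.
have sh : alpha (s^-1 * h)%g = 1 by rewrite sgnM sgnV s_out hN mulrNN mulr1.
have hs : alpha (h * s)%g = 1 by rewrite sgnM s_out hN mulrNN mulr1.
rewrite (ind_mx_out s_out) // mul_row_block !mulmx0 addr0 add0r mul_mx_row.
congr row_mx; last by rewrite -sP mulmxA -piM rho_PE.
by rewrite -sP -[in RHS]mulmxA -(rho_PE sh) mulmxA -piM -sVh.
Qed.

Definition universal_U := rep_sum Q_rep (rep_ind P_rep s_out).

Lemma rho_decomp : rep_iso (spin_rep rho) (rep_sum universal_U (rep_sgn alpha)).
Proof.
have BB := frame_mx_orth B; have BBt := mulmx1C_eq erefl BB.
exists (frame_mx B)^T, (frame_mx B); split=> // h.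
have hE : pi (rho h) *m frame_mx B =
    frame_mx B *m rep_sum universal_U (rep_sgn alpha) h.
  have -> : rep_sum universal_U (rep_sgn alpha) h =
      block_mx (block_mx (Q_rep h) 0 0 (ind_mx P_rep s h)) 0 0 (alpha h)%:M by [].
  rewrite /frame_mx !mul_mx_row !mul_row_block !(mulmx0, addr0, add0r).
  have := rho_PP'E h; rewrite mul_mx_row mul_row_block => ->.
  have -> : bQ *m Q_rep h = pi (rho h) *m bQ by rewrite [RHS]rho_Q.
  by rewrite mul_mx_scalar [pi _ *m bL](hgrp_actL B h).
by rewrite -[LHS]mulmx1 -BBt !mulmxA -(mulmxA _ _ (frame_mx B)) hE !mulmxA
  BB mul1mx.
Qed.

Lemma universal_U_contains : rep_contains (rep_res alpha universal_U) P_rep.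
Proof.
exists (col_mx 0 (col_mx 1%:M 0)); split=> [|x].
  by rewrite rank_col_0mx rank_col_mx0 mxrank1.
have x1 : alpha (val x) = 1 by case: x => x /= /eqP.
rewrite /= ind_mx_in // !mul_block_col !mul_col_mx.
rewrite !(mulmx0, mul0mx, addr0, add0r) mulmx1 mul1mx.
by rewrite ker_extE.
Qed.

End Swap.

Lemma eps_unacceptable : unacceptable rho epsH.
Proof.
split; first exact: (eps_conj_each eps_det B).
exact: eps_not_in_X eps_det B.
Qed.

Lemma rho_type_IIIa : type_IIIa rho epsH alpha.
Proof.
have e1 : dotv (delta_mx 0 0 : 'cV[R]_2) (delta_mx 0 0) = 1.
  exact: dotv_delta1.
have [s [sP _ _ sN]] := hgrp_swap B e1.
have [h0 [_ _ _ h0e]] := hgrp_refl_pair eps_det B e1 e1.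
have N1 : -1 <> 1 :> R.
  by apply/eqP; rewrite eq_sym -subr_eq0 opprK paddr_eq0 ?ler01 // oner_eq0.
have eps_nt : sgn_nontrivial epsH by exists h0; rewrite h0e.
have rank1 (X : 'M[R]_(7, 1)) : X^T *m X = 1%:M -> \rank X = 1%N.
  by move=> XX; apply/eqP; rewrite -mxrank_tr -/(row_free _); apply/row_freeP;
    exists X.
split=> //.
- split.
  + by exists s; rewrite sN.
  + exists bL; split=> [|h]; first exact: rank1 (bL_unit B).
    by rewrite /= mul_mx_scalar [LHS](hgrp_actL B h).
  + case=> A [Ar hA]; suff A0 : A = 0 by rewrite A0 mxrank0 in Ar.
    by apply: (rho_no_invariant eps_det B) => h; rewrite [LHS]hA /= mulmx1.
  + exists epsH; split=> //; first exact: eps_unacceptable.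
    case=> _; apply; have [g gE] := eps_conj_ker eps_det B.
    exists g => x; apply: (gE (ker_incl x)).
    by case: x => x /= /eqP.
- exact: eps_not_in_X eps_det B.
- exists (universal_U sN); split; first exact: rho_decomp sN sP.
  exists P_rep, Q_rep, s, sN; split.
  + exact: universal_U_contains.
  + exact: P_rep_det.
  + exact: Q_rep_det.
  + exact: rep_iso_refl.
Qed.

End UniversalModule.

Theorem theorem7p4 (R : realType) (D : frame R) (eps : sgnchar R (hbar D))
    (eps_det : forall f : hbar D, hbar_alpha D f = 1 ->
       eps f = det_on (frP D) f /\ eps f = det_on (frP' D) f) :
  type_IIIa (@hgrp_incl R D) (inflate eps) (inflate (hbar_alpha D))
  /\
  (forall (Gamma : groupType) (chi : sgnchar R Gamma)
      (r : {multiplicative Gamma -> spin R 7}) (eta : sgnchar R Gamma),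
    sgn_nontrivial chi ->
    type_IIIa r eta chi ->
    exists (g : spin R 7) (f : {multiplicative Gamma -> hgrp D}),
      [/\ forall x, hgrp_incl (f x) = (g * r x * g^-1)%g,
          forall x, chi x = inflate (hbar_alpha D) (f x)
        & forall x, eta x = inflate eps (f x)]).
Proof.
split; last by move=> Gamma chi r eta _; exact: IIIa_factors.
by have [B] := adapted_basis_exists D; exact: rho_type_IIIa.
Qed.
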